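(* Let $Y=Y_1\times Y_2$ and $X=X_1\times X_2$ be products of compact connected complex manifolds. Assume that $X_1$ is a compact Riemann surface of genus $\geq 2$. Let $F=(F_1,F_2): Y\longrightarrow X$ be a holomorphic map, where $F_i:Y\longrightarrow X_i$, $i=1,2$, are its components. Then there is a $j\in \{1,2\}$ such that $F$ has the form $F(y_1, y_2)=(F_1(y_j), F_2(y_1,y_2))$ for all $(y_1,y_2)\in Y_1\times Y_2$; that is, the component $F_1$ depends only on the variable $y_j\in Y_j$.
   Context: A Riemann surface is a connected complex manifold of complex dimension one. Writing $F_1(y_j)$ means that $F_1(y_1,y_2)$ depends only on $y_j$, so that $F_1$ may be regarded as a map $Y_j\longrightarrow X_1$. *)

(* Defs.v *)
From HB Require Import structures.
From mathcomp Require Import all_boot all_order all_algebra complex.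
From mathcomp Require Import all_classical all_reals all_analysis.
Set Implicit Arguments.
Unset Strict Implicit.
Unset Printing Implicit Defensive.
Import Order.TTheory GRing.Theory Num.Theory.
Import numFieldNormedType.Exports.
Local Open Scope classical_set_scope.
Local Open Scope ring_scope.

(* [R[i]] packed as a [numClosedFieldType], so that the topology and the norm
   that MathComp-Analysis puts on numeric fields, and hence on matrices over
   them, are inferred; [differentiable] over it is complex differentiability. *)
Definition Cplx (R : realType) : numClosedFieldType := R[i].

Section Charts.
Variables (R : realType) (T : topologicalType) (n : nat).

(* A homeomorphism from an open subset of [T] onto an open subset of C^n.
   [cinv] is a total function, meaningful on the image of [cdom] only. *)
Record chart := Chart {
  cdom : set T ;
  cfun : T -> 'rV[Cplx R]_n ;
  cinv : 'rV[Cplx R]_n -> T ;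
  cdom_open : open cdom ;
  cimg_open : open (cfun @` cdom) ;
  cfunK : {in cdom, cancel cfun cinv} ;
  cfun_cont : {within cdom, continuous cfun} ;
  cinv_cont : {within cfun @` cdom, continuous cinv}
}.

Definition transition (c d : chart) : 'rV[Cplx R]_n -> 'rV[Cplx R]_n :=
  cfun d \o cinv c.

(* The transition map between two charts is holomorphic on the open set
   [cfun c @` (cdom c `&` cdom d)]. *)
Definition compatible (c d : chart) : Prop :=
  forall x, cdom c x -> cdom d x -> differentiable (transition c d) (cfun c x).

End Charts.

(* The atlas need not be maximal. *)
Record complexManifold (R : realType) (n : nat) := ComplexManifold {
  carrier :> topologicalType ;
  atlas : set (chart R carrier n) ;
  manifold_hausdorff : hausdorff_space carrier ;
  manifold_second_countable : @second_countable carrier ;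
  atlas_cover : forall x : carrier, exists2 c, atlas c & cdom c x ;
  atlas_compatible : forall c d, atlas c -> atlas d -> compatible c d
}.

Definition holomorphic (R : realType) (m n : nat) (M : complexManifold R m)
    (N : complexManifold R n) (f : M -> N) : Prop :=
  continuous f /\
  forall (c : chart R M m) (d : chart R N n), atlas c -> atlas d ->
    forall x, cdom c x -> cdom d (f x) ->
      differentiable (cfun d \o f \o cinv c) (cfun c x).

Section ProductCharts.
Variables (R : realType) (T U : topologicalType) (m n : nat).
Variables (c : chart R T m) (d : chart R U n).

Definition prod_cdom : set (T * U) := cdom c `*` cdom d.
Definition prod_cfun (p : T * U) : 'rV[Cplx R]_(m + n) :=
  row_mx (cfun c p.1) (cfun d p.2).
Definition prod_cinv (v : 'rV[Cplx R]_(m + n)) : T * U :=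
  (cinv c (lsubmx v), cinv d (rsubmx v)).

Lemma prod_cdom_open : open prod_cdom.
Proof.
rewrite openE => -[x y] [/= cx dy]; exists (cdom c, cdom d) => //=.
by split; apply: open_nbhs_nbhs; split=> //; exact: cdom_open.
Qed.

Lemma prod_cimgE : prod_cfun @` prod_cdom =
  (lsubmx @^-1` (cfun c @` cdom c)) `&` (rsubmx @^-1` (cfun d @` cdom d)).
Proof.
apply/seteqP; split=> [_ [[x y] [/= cx dy] <-]|v [[x cx xv] [y dy yv]]].
  by rewrite /prod_cfun/=; split=> /=; rewrite ?row_mxKl ?row_mxKr;
    [exists x|exists y].
by exists (x, y) => //; rewrite /prod_cfun /= xv yv hsubmxK.
Qed.

Lemma prod_cimg_open : open (prod_cfun @` prod_cdom).
Proof.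
rewrite prod_cimgE; apply: openI.
  by apply: open_comp; [move=> ? _; exact: continuous_lsubmx|exact: cimg_open].
by apply: open_comp; [move=> ? _; exact: continuous_rsubmx|exact: cimg_open].
Qed.

Lemma prod_cfunK : {in prod_cdom, cancel prod_cfun prod_cinv}.
Proof.
move=> [x y] /set_mem[/= cx dy]; rewrite /prod_cinv /prod_cfun/=.
by rewrite row_mxKl row_mxKr !cfunK//; exact: mem_set.
Qed.

Lemma prod_cfun_cont : {within prod_cdom, continuous prod_cfun}.
Proof.
rewrite continuous_open_subspace; last exact: prod_cdom_open.
move=> [x y] /set_mem[/= cx dy].
have cfc : {for x, continuous (cfun c)}.
  have := @cfun_cont _ _ _ c.
  by rewrite continuous_open_subspace; [apply; exact: mem_set|exact: cdom_open].
have dfc : {for y, continuous (cfun d)}.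
  have := @cfun_cont _ _ _ d.
  by rewrite continuous_open_subspace; [apply; exact: mem_set|exact: cdom_open].
have fstc : (cfun c \o fst) @ ((x, y) : T * U) --> cfun c x.
  by apply: cvg_comp; [exact: cvg_fst|exact: cfc].
have sndc : (cfun d \o snd) @ ((x, y) : T * U) --> cfun d y.
  by apply: cvg_comp; [exact: cvg_snd|exact: dfc].
apply/cvg_ballP => e e0.
move: fstc => /cvg_ballP/(_ e e0) fstc; move: sndc => /cvg_ballP/(_ e e0) sndc.
apply: filterS (filterI fstc sndc) => -[x' y'] [/= [_ bx] [_ by']].
split=> // i j; rewrite /prod_cfun/=.
by rewrite !mxE; case: (fintype.split j) => k.
Qed.

Lemma prod_cinv_cont : {within prod_cfun @` prod_cdom, continuous prod_cinv}.
Proof.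
rewrite continuous_open_subspace; last exact: prod_cimg_open.
move=> v /set_mem; rewrite prod_cimgE => -[/= cv dv].
have cfc : {for lsubmx v, continuous (cinv c)}.
  have := @cinv_cont _ _ _ c.
  by rewrite continuous_open_subspace; [apply; exact: mem_set|exact: cimg_open].
have dfc : {for rsubmx v, continuous (cinv d)}.
  have := @cinv_cont _ _ _ d.
  by rewrite continuous_open_subspace; [apply; exact: mem_set|exact: cimg_open].
have lc := @continuous_comp _ _ _ lsubmx (cinv c) v
  (@continuous_lsubmx _ _ _ _ v) cfc.
have rc := @continuous_comp _ _ _ rsubmx (cinv d) v
  (@continuous_rsubmx _ _ _ _ v) dfc.
apply: cvg_pair; [exact: nbhs_filter|exact: lc|exact: rc].
Qed.

Definition prod_chart : chart R (T * U)%type (m + n) :=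
  Chart prod_cdom_open prod_cimg_open prod_cfunK prod_cfun_cont prod_cinv_cont.

End ProductCharts.

Lemma differentiable_row_mx (K : numFieldType) (V : normedModType K) (m n : nat)
    (f : V -> 'rV[K]_m) (g : V -> 'rV[K]_n) (x : V) :
  differentiable f x -> differentiable g x ->
  differentiable (fun v => row_mx (f v) (g v)) x.
Proof.
move=> df dg.
have row_mx_linear : linear (fun p : 'rV[K]_m * 'rV[K]_n => row_mx p.1 p.2).
  by move=> a [u1 u2] [v1 v2] /=; rewrite scale_row_mx add_row_mx.
pose L := GRing.isLinear.Build _ _ _ _ _ row_mx_linear.
pose h : {linear ('rV[K]_m * 'rV[K]_n)%type -> 'rV[K]_(m + n)} :=
  HB.pack (fun p : 'rV[K]_m * 'rV[K]_n => row_mx p.1 p.2) L.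
rewrite (_ : (fun v => _) = h \o (fun v => (f v, g v)))//.
apply: differentiable_comp; first exact: differentiable_pair.
apply: linear_differentiable => -[u1 u2] /= A /nbhs_ballP[e /= e0 eA].
apply/nbhs_ballP; exists e => //= -[v1 v2] [/= [_ b1] [_ b2]].
apply: eA; split => // i j.
by rewrite !mxE; case: (fintype.split j) => k.
Qed.

Section ProductManifold.
Variables (R : realType) (m n : nat).
Variables (M : complexManifold R m) (N : complexManifold R n).

Definition prod_atlas : set (chart R (M * N)%type (m + n)) :=
  [set e | exists c d, [/\ atlas c, atlas d & e = prod_chart c d]].

Lemma prod_hausdorff : hausdorff_space (M * N)%type.
Proof.
move=> [x1 x2] [y1 y2] xy; congr (_, _).
  apply: manifold_hausdorff => A B xA yB.
  have nA : nbhs ((x1, x2) : (M * N)%type) (A `*` setT).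
    by exists (A, setT) => //; split=> //=; exact: filterT.
  have nB : nbhs ((y1, y2) : (M * N)%type) (B `*` setT).
    by exists (B, setT) => //; split=> //=; exact: filterT.
  by have [[z1 z2] [/= [Az _] [Bz _]]] := xy _ _ nA nB; exists z1.
apply: manifold_hausdorff => A B xA yB.
have nA : nbhs ((x1, x2) : (M * N)%type) (setT `*` A).
  by exists (setT, A) => //; split=> //=; exact: filterT.
have nB : nbhs ((y1, y2) : (M * N)%type) (setT `*` B).
  by exists (setT, B) => //; split=> //=; exact: filterT.
by have [[z1 z2] [/= [_ Az] [_ Bz]]] := xy _ _ nA nB; exists z2.
Qed.

Lemma prod_second_countable : @second_countable (M * N)%type.
Proof.
have [B cB [oB bB]] := @manifold_second_countable _ _ M.
have [D cD [oD bD]] := @manifold_second_countable _ _ N.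
exists [set p.1 `*` p.2 | p in B `*` D].
  exact: sub_countable (card_image_le _ _) (countableX cB cD).
split=> [_ [[U V] [/= BU DV] <-]|[x y] A [[P Q] [/= xP yQ] PQA]].
  rewrite openE => -[u v] [/= Uu Vv]; exists (U, V) => //=.
  by split; apply: open_nbhs_nbhs; split=> //; [exact: oB|exact: oD].
have [U [BU Ux] UP] := bB x P xP; have [V [DV Vy] VQ] := bD y Q yQ.
exists (U `*` V).
  by split=> //; exists (U, V).
by move=> [u v] [/= Uu Vv]; apply: PQA; split; [exact: UP|exact: VQ].
Qed.

Lemma prod_atlas_cover (p : (M * N)%type) :
  exists2 e, prod_atlas e & cdom e p.
Proof.
case: p => x y; have [c ac cx] := atlas_cover x.
have [d ad dy] := atlas_cover y.
by exists (prod_chart c d) => //; exists c, d.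
Qed.

Lemma prod_atlas_compatible e e' :
  prod_atlas e -> prod_atlas e' -> compatible e e'.
Proof.
move=> [c [d [ac ad ->]]] [c' [d' [ac' ad' ->]]] [x y] [/= cx dy] [/= c'x d'y].
apply: differentiable_row_mx => /=.
  apply: (@differentiable_comp _ _ _ _ lsubmx (transition c c')).
    exact: differentiable_lsubmx.
  by rewrite row_mxKl; exact: (atlas_compatible ac ac').
apply: (@differentiable_comp _ _ _ _ rsubmx (transition d d')).
  exact: differentiable_rsubmx.
by rewrite row_mxKr; exact: (atlas_compatible ad ad').
Qed.

Definition prod_manifold : complexManifold R (m + n) :=
  ComplexManifold prod_hausdorff prod_second_countable prod_atlas_cover
    prod_atlas_compatible.

End ProductManifold.

Section OneForms.
Variables (R : realType) (n : nat) (M : complexManifold R n).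

(* [w c x] is the column of coefficients, in the chart [c], of the covector
   [w] at the point [x]; it is meaningful for [c] in the atlas and [x] in
   [cdom c] only. *)
Definition one_form_coef := chart R M n -> M -> 'cV[Cplx R]_n.

(* Vectors are rows and ['J f p] acts on them on the right, so the chain rule
   for covectors reads w_c = J(d o c^-1) w_d. *)
Definition holomorphic_one_form (w : one_form_coef) : Prop :=
  (forall c d, atlas c -> atlas d -> forall x, cdom c x -> cdom d x ->
     w c x = 'J (transition c d) (cfun c x) *m w d x) /\
  (forall c, atlas c -> forall x, cdom c x ->
     differentiable (w c \o cinv c) (cfun c x)).

Definition one_form_eq (w w' : one_form_coef) : Prop :=
  forall c, atlas c -> forall x, cdom c x -> w c x = w' c x.

Definition one_form_comb (g : nat) (a : 'I_g -> Cplx R)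
    (w : 'I_g -> one_form_coef) : one_form_coef :=
  fun c x => \sum_(i < g) a i *: w i c x.

Definition one_form_basis (g : nat) (w : 'I_g -> one_form_coef) : Prop :=
  [/\ forall i, holomorphic_one_form (w i),
      forall a, one_form_eq (one_form_comb a w) (fun _ _ => 0) ->
        forall i, a i = 0
    & forall e, holomorphic_one_form e ->
        exists a, one_form_eq e (one_form_comb a w)].

End OneForms.

(* The dimension of H^0(X, Omega^1), which is finite when [X] is compact; 0 by
   convention if it is infinite. *)
Definition genus (R : realType) (X : complexManifold R 1) : nat :=
  xget 0%N [set g | exists w : 'I_g -> one_form_coef X, one_form_basis w].

Definition compact_connected (T : topologicalType) : Prop :=
  compact [set: T] /\ connected [set: T].

(* Main.v *)
(* Write f for F_1. If w is a holomorphic 1-form on X_1, the component of f^*w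
   along Y_1 at a point y_1 is, as a function of y_2, a holomorphic function on
   the compact connected manifold Y_2, hence constant; likewise with the factors
   exchanged. Suppose that f depends on both variables and let w_1, w_2 be
   independent forms. Then there are a tangent vector at some a in Y_1 on which
   f^*w_1 is nonzero and one at some b in Y_2 on which f^*w_2 is nonzero, so
   that w_1 and w_2 do not vanish at f(a, b). Choose q such that w = w_1 - q w_2
   vanishes there. The Y_2-component of f^*w at b is then zero for all y_1.
   Since w is not zero, the Y_1-component of f^*w is nonzero at some a' near a;
   at (a', b) the form w does not vanish, so the derivative of f along Y_2 is
   zero there, although f^*w_2 is nonzero on the same vector.

   Rather than proving that the derivative of a holomorphic function is
   holomorphic, the first step integrates w along short curves in Y_1: the
   integral is, by composition with a local primitive of w, holomorphic in y_2,
   so it is independent of y_2, and one differentiates afterwards. The only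
   complex analysis needed is Goursat's theorem on rectangles, which gives local
   primitives and, through the coordinates exp (x + i y), the mean value
   property and the maximum principle at the center of a disc. The identity
   principle and the open mapping property are derived from the latter. *)
From HB Require Import structures.
Require Import Defs.
From mathcomp Require Import all_boot all_order all_algebra complex.
From mathcomp Require Import all_classical all_reals all_analysis.
From mathcomp Require Import ring lra.
Set Implicit Arguments.
Unset Strict Implicit.
Unset Printing Implicit Defensive.
Import Order.TTheory GRing.Theory Num.Theory.
Import numFieldNormedType.Exports Normc.
Local Open Scope classical_set_scope.
Local Open Scope ring_scope.

(** * Real differentiable closed forms on a rectangle *)

(** The derivatives at [a] and [b] are two-sided, so [f] is first extended by constants: composed
    with the clamp [cl] onto [[a, b]] it is continuous on the whole line, and its integral from
    [a - 1] is differentiable at both endpoints. *)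
Lemma continuous_primitive (R : realType) (f : R -> R) (a b : R) : a <= b ->
  (forall x, a <= x <= b -> forall e : R, 0 < e -> exists2 d : R, 0 < d &
     forall y, a <= y <= b -> `|y - x| < d -> `|f y - f x| <= e) ->
  exists F : R -> R, forall x, a <= x <= b -> is_derive x 1 F (f x).
Proof.
move=> ab fcont; pose cl x := Num.max a (Num.min x b).
have clP x : a <= cl x <= b.
  by rewrite /cl ge_max le_max lexx ab ge_min lexx orbT.
have clid x : a <= x <= b -> cl x = x.
  by move=> /andP[h1 h2]; rewrite /cl min_l// max_r.
have clc : continuous cl.
  move=> x; apply: (@continuous_max _ _ (cst a) (fun x : R => Num.min x b)).
    exact: cst_continuous.
  by apply: (@continuous_min _ _ id (cst b)) => //; exact: cst_continuous.
have gc : continuous (f \o cl).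
  move=> x; apply/cvgrPdist_le => e e0.
  have [d d0 H] := fcont _ (clP x) _ e0.
  have /cvgrPdist_lt/(_ d d0) := clc x; apply: filterS => y yd.
  by rewrite /= distrC; apply: H => //; rewrite distrC.
pose F x := (\int[@lebesgue_measure R]_(t in [set` `[a - 1, x]]) (f \o cl) t)%R.
exists F => x /andP[ax xb].
have [||||Fd FE] := @continuous_FTC1_closed R (f \o cl) (a - 1) x (b + 1).
- by lra.
- apply: continuous_compact_integrable; first exact: segment_compact.
  exact: continuous_subspaceT.
- by lra.
- exact: gc.
have -> : f x = 'D_1 F x by rewrite -derive1E FE /= clid// ax.
exact: DeriveDef.
Qed.

Lemma is_derive_within (R : realType) (f df : R -> R) (a b : R) :
  (forall x, a <= x <= b -> is_derive x 1 f (df x)) ->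
  {within `[a, b], continuous f}.
Proof.
move=> fd; apply: derivable_within_continuous => x; rewrite in_itv /= => xab.
by have [] := fd x xab.
Qed.

(** Mean value theorem for [F] minus a primitive of the affine function. The slope [k] serves
    Goursat's theorem; elsewhere it is 0. *)
Lemma primitive_near_affine (R : realType) (F f : R -> R) (a b c k p eta : R) :
  a <= b -> (forall x, a <= x <= b -> is_derive x 1 F (f x)) ->
  (forall x, a <= x <= b -> `|f x - (c + k * (x - p))| <= eta) ->
  `|F b - F a - (c * (b - a) + k * ((b - p) ^+ 2 - (a - p) ^+ 2) / 2)|
    <= eta * (b - a).
Proof.
move=> ab Fd fb.
pose G x := F x - (c * x + k * (x - p) ^+ 2 / 2).
have Gd x : a <= x <= b -> is_derive x 1 G (f x - (c + k * (x - p))).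
  move=> /Fd dF; rewrite /G.
  have -> : (fun x => F x - (c * x + k * (x - p) ^+ 2 / 2)) =
     F - (c *: id + (k / 2) *: ((id - cst p) * (id - cst p))) :> (R -> R).
    by apply/funext => z; rewrite !fctE/= /GRing.scale/= expr2 mulrAC.
  have dp : is_derive x 1 ((id - cst p) : R -> R) (1 - 0).
    exact: (is_deriveB (is_derive_id x 1) (is_derive_cst p x 1)).
  have dq := is_deriveD (is_deriveZ c (is_derive_id x 1))
    (is_deriveZ (k / 2) (is_deriveM dp dp)).
  apply: (is_derive_eq (is_deriveB dF dq)).
  by rewrite !fctE /GRing.scale /=; field.
have [z] : exists2 z, z \in `[a, b]%R &
    G b - G a = (f z - (c + k * (z - p))) * (b - a).
  apply: (@MVT_segment _ G (fun z => f z - (c + k * (z - p)))) => //.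
    move=> y; rewrite in_itv /= => /andP[ay yb]; apply: Gd.
    by rewrite !ltW.
  exact: is_derive_within Gd.
rewrite in_itv /= => zab GE.
have -> : F b - F a - (c * (b - a) + k * ((b - p) ^+ 2 - (a - p) ^+ 2) / 2) =
    G b - G a by rewrite /G; field.
by rewrite GE normrM [X in _ * X]ger0_norm ?subr_ge0// ler_wpM2r ?subr_ge0// fb.
Qed.

(** The point is the supremum of the left endpoints: by nesting, every right endpoint bounds all of
    them. *)
Lemma nested_point (R : realType) (a : nat -> R) (w : nat -> R) :
  (forall n, 0 <= w n) ->
  (forall n, a n <= a n.+1 /\ a n.+1 + w n.+1 <= a n + w n) ->
  exists p, forall n, a n <= p <= a n + w n.
Proof.
move=> w0 H.
have amono m n : (m <= n)%N -> a m <= a n.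
  elim: n => [|n IH]; first by rewrite leqn0 => /eqP->.
  rewrite leq_eqVlt => /predU1P[->//|]; rewrite ltnS => /IH h.
  exact: le_trans h (H n).1.
have bmono m n : (m <= n)%N -> a n + w n <= a m + w m.
  elim: n => [|n IH]; first by rewrite leqn0 => /eqP->.
  rewrite leq_eqVlt => /predU1P[->//|]; rewrite ltnS => /IH h.
  exact: le_trans (H n).2 h.
have ub n : ubound (range a) (a n + w n).
  move=> _ [m _ <-]; have [mn|nm] := leqP m n.
    by rewrite (le_trans (amono _ _ mn))// lerDl.
  by rewrite (le_trans _ (bmono _ _ (ltnW nm)))// lerDl.
exists (sup (range a)) => n; apply/andP; split.
  by apply: ub_le_sup; [exists (a 0%N + w 0%N); exact: ub|exists n].
by apply: ge_sup; [exists (a 0%N), 0%N|exact: ub].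
Qed.

(** * Goursat's theorem on a rectangle *)

Section Rectangle.
Variables (R : realType) (u v : R -> R -> R) (x0 x1 y0 y1 : R).

(* [u] and [v] are real differentiable at each point of the rectangle and the
   1-form [v dx + u dy] has zero exterior derivative there; nothing is assumed
   on the continuity of the derivatives. *)
Definition closed_form_on : Prop :=
  forall x y, x0 <= x <= x1 -> y0 <= y <= y1 -> exists p q r : R,
  forall e : R, 0 < e -> exists2 d : R, 0 < d &
  forall x' y', x0 <= x' <= x1 -> y0 <= y' <= y1 ->
    `|x' - x| < d -> `|y' - y| < d ->
    `|v x' y' - v x y - (p * (x' - x) + q * (y' - y))|
      <= e * (`|x' - x| + `|y' - y|) /\
    `|u x' y' - u x y - (q * (x' - x) + r * (y' - y))|
      <= e * (`|x' - x| + `|y' - y|).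

Hypothesis cf : closed_form_on.

Lemma closed_form_continuous x y : x0 <= x <= x1 -> y0 <= y <= y1 ->
  forall e : R, 0 < e -> exists2 d : R, 0 < d &
  forall x' y', x0 <= x' <= x1 -> y0 <= y' <= y1 ->
    `|x' - x| < d -> `|y' - y| < d ->
    `|v x' y' - v x y| <= e /\ `|u x' y' - u x y| <= e.
Proof.
move=> hx hy e e0; have [p [q [r H]]] := cf hx hy.
have [d d0 {}H] := H 1 ltr01.
(* With tolerance 1, the increments of [u] and [v] near the point are at most [C] times the sum of
   the distances in the two coordinates. *)
pose C := 1 + `|p| + `|q| + `|r|.
have C0 : 0 < C by rewrite !ltr_pwDl.
have CE : C - 1 = `|p| + `|q| + `|r| by rewrite /C; ring.
exists (Num.min d (e / 2 / C)); first by rewrite lt_min d0 !divr_gt0.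
move=> x' y' hx' hy'; rewrite !lt_min => /andP[xd xe] /andP[yd ye].
have [k1 k2] := H x' y' hx' hy' xd yd.
have {xe ye} se : C * (`|x' - x| + `|y' - y|) <= e.
  move: xe ye; rewrite !ltr_pdivlMr// => xe ye.
  by rewrite mulrC mulrDl; lra.
have lin a b : `|a| <= `|p| + `|q| + `|r| -> `|b| <= `|p| + `|q| + `|r| ->
    `|a * (x' - x) + b * (y' - y)| <= (C - 1) * (`|x' - x| + `|y' - y|).
  move=> ha hb; apply: le_trans (ler_normD _ _) _; rewrite !normrM mulrDr.
  by rewrite CE; apply: lerD; apply: ler_pM.
have p0 := normr_ge0 p; have q0 := normr_ge0 q; have r0 := normr_ge0 r.
move: k1 k2; rewrite mul1r => k1 k2; split.
  rewrite -(subrK (p * (x' - x) + q * (y' - y)) (v x' y' - v x y)).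
  apply: le_trans (ler_normD _ _) _; apply: le_trans se.
  have := lin p q; set L := `|p * _ + _|; move: k1; set N := _ + `|y' - y|.
  by rewrite -/N mulrBl mul1r => k1 /(_ (ltac:(lra)) (ltac:(lra))); lra.
rewrite -(subrK (q * (x' - x) + r * (y' - y)) (u x' y' - u x y)).
apply: le_trans (ler_normD _ _) _; apply: le_trans se.
have := lin q r; set L := `|q * _ + _|; move: k2; set N := _ + `|y' - y|.
by rewrite -/N mulrBl mul1r => k2 /(_ (ltac:(lra)) (ltac:(lra))); lra.
Qed.

(** A primitive is chosen on each horizontal and each vertical line separately. The additive
    constants are unrelated from line to line, so only increments along one line have a meaning. *)
Lemma closed_form_primitives : x0 <= x1 -> y0 <= y1 ->
  exists V U : R -> R -> R,
  (forall x y, x0 <= x <= x1 -> y0 <= y <= y1 ->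
    is_derive x 1 (V y) (v x y)) /\
  (forall x y, x0 <= x <= x1 -> y0 <= y <= y1 ->
    is_derive y 1 (U x) (u x y)).
Proof.
move=> x01 y01.
have cV y : y0 <= y <= y1 -> exists F : R -> R,
    forall x, x0 <= x <= x1 -> is_derive x 1 F (v x y).
  move=> hy; apply: continuous_primitive => // x hx e e0.
  have [d d0 H] := closed_form_continuous hx hy e0; exists d => // z hz zd.
  by have [] := H z y hz hy zd (ltac:(by rewrite subrr normr0)).
have cU x : x0 <= x <= x1 -> exists F : R -> R,
    forall y, y0 <= y <= y1 -> is_derive y 1 F (u x y).
  move=> hx; apply: continuous_primitive => // y hy e e0.
  have [d d0 H] := closed_form_continuous hx hy e0; exists d => // z hz zd.
  by have [] := H x z hx hz (ltac:(by rewrite subrr normr0)) zd.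
have [V HV] : {V : R -> R -> R & forall y, y0 <= y <= y1 ->
    forall x, x0 <= x <= x1 -> is_derive x 1 (V y) (v x y)}.
  apply: (@choice _ _ (fun y F => y0 <= y <= y1 ->
    forall x, x0 <= x <= x1 -> is_derive x 1 F (v x y))) => y.
  have [/cV[F HF]|hy] := pselect (y0 <= y <= y1); first by exists F.
  by exists (fun=> 0).
have [U HU] : {U : R -> R -> R & forall x, x0 <= x <= x1 ->
    forall y, y0 <= y <= y1 -> is_derive y 1 (U x) (u x y)}.
  apply: (@choice _ _ (fun x F => x0 <= x <= x1 ->
    forall y, y0 <= y <= y1 -> is_derive y 1 F (u x y))) => x.
  have [/cU[F HF]|hy] := pselect (x0 <= x <= x1); first by exists F.
  by exists (fun=> 0).
by exists V, U; split=> x y hx hy; [exact: HV|exact: HU].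
Qed.

Variables V U : R -> R -> R.
Hypothesis HV : forall x y, x0 <= x <= x1 -> y0 <= y <= y1 ->
  is_derive x 1 (V y) (v x y).
Hypothesis HU : forall x y, x0 <= x <= x1 -> y0 <= y <= y1 ->
  is_derive y 1 (U x) (u x y).

(** The integral of [v dx + u dy] counterclockwise around the rectangle [[a, a'] x [b, b']],
    computed with the primitives on its four sides. *)
Definition circulation (a a' b b' : R) : R :=
  (V b a' - V b a) + (U a' b' - U a' b) - (V b' a' - V b' a) -
  (U a b' - U a b).

(** The affine form is closed, because [q] is both the [y]-slope of one coefficient and the
    [x]-slope of the other, so its four side integrals cancel. The remainder contributes at most
    [eta] times the perimeter. *)
Lemma circulation_small (p q r v0 u0 px py eta a a' b b' : R) :
  a <= a' -> b <= b' -> x0 <= a -> a' <= x1 -> y0 <= b -> b' <= y1 ->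
  (forall x y, a <= x <= a' -> b <= y <= b' ->
    `|v x y - v0 - (p * (x - px) + q * (y - py))| <= eta /\
    `|u x y - u0 - (q * (x - px) + r * (y - py))| <= eta) ->
  `|circulation a a' b b'| <= 2 * eta * ((a' - a) + (b' - b)).
Proof.
move=> aa bb xa ax yb by1 H.
have Vb y : b <= y <= b' ->
    `|V y a' - V y a - ((v0 + q * (y - py)) * (a' - a)
       + p * ((a' - px) ^+ 2 - (a - px) ^+ 2) / 2)| <= eta * (a' - a).
  move=> /andP[by_ yb_].
  apply: (@primitive_near_affine _ _ (v ^~ y)) => // x /andP[ax_ xa_].
    by apply: HV; apply/andP; split; lra.
  have [+ _] := H x y (ltac:(apply/andP; split; lra)) (ltac:(apply/andP; split; lra)).
  by congr (`|_| <= _); ring.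
have Ub x : a <= x <= a' ->
    `|U x b' - U x b - ((u0 + q * (x - px)) * (b' - b)
       + r * ((b' - py) ^+ 2 - (b - py) ^+ 2) / 2)| <= eta * (b' - b).
  move=> /andP[ax_ xa_].
  apply: (@primitive_near_affine _ _ (u x)) => // y /andP[by_ yb_].
    by apply: HU; apply/andP; split; lra.
  have [_] := H x y (ltac:(apply/andP; split; lra)) (ltac:(apply/andP; split; lra)).
  by congr (`|_| <= _); ring.
have := Vb b (ltac:(by rewrite lexx)); have := Vb b' (ltac:(by rewrite lexx andbT)).
have := Ub a (ltac:(by rewrite lexx)); have := Ub a' (ltac:(by rewrite lexx andbT)).
rewrite !ler_norml /circulation.
set A1 := V b a' - _; set A2 := V b' a' - _; set A3 := U a b' - _; set A4 := U a' b' - _.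
have E : ((v0 + q * (b - py)) * (a' - a) + p * ((a' - px) ^+ 2 - (a - px) ^+ 2) / 2) -
 ((v0 + q * (b' - py)) * (a' - a) + p * ((a' - px) ^+ 2 - (a - px) ^+ 2) / 2) +
 ((u0 + q * (a' - px)) * (b' - b) + r * ((b' - py) ^+ 2 - (b - py) ^+ 2) / 2) -
 ((u0 + q * (a - px)) * (b' - b) + r * ((b' - py) ^+ 2 - (b - py) ^+ 2) / 2) = 0 by field.
move: E; set B1 := (v0 + _) * _ + _; set B2 := (v0 + _) * _ + _.
set B3 := (u0 + _) * _ + _; set B4 := (u0 + _) * _ + _.
move=> E /andP[h1 h2] /andP[h3 h4] /andP[h5 h6] /andP[h7 h8].
rewrite -mulrA mulrDr; set C1 := eta * (a' - a); set C2 := eta * (b' - b).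
by rewrite -/C1 -/C2 in h1 h2 h3 h4 h5 h6 h7 h8; apply/andP; split; lra.
Qed.

(** Repeated quartering, keeping a quarter with the largest share of the circulation, leads to a
    limit point [(px, py)]. Differentiability there makes the circulation of the [n]-th rectangle
    small compared with the square of its size, that is with [4 ^+ n] in the denominator, which
    beats the loss of a factor 4 per step. *)
Lemma goursat_rectangle a a' b b' :
  a <= a' -> b <= b' -> x0 <= a -> a' <= x1 -> y0 <= b -> b' <= y1 ->
  circulation a a' b b' = 0.
Proof.
move=> aa bb xa ax yb by1.
pose w n : R := (a' - a) / 2 ^+ n; pose h n : R := (b' - b) / 2 ^+ n.
have p2 n : 0 < (2 : R) ^+ n by rewrite exprn_gt0.
have wS n : w n = w n.+1 + w n.+1.
  by rewrite /w exprS; field; rewrite gt_eqF.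
have hS n : h n = h n.+1 + h n.+1.
  by rewrite /h exprS; field; rewrite gt_eqF.
have w0 n : 0 <= w n by rewrite divr_ge0 ?subr_ge0// ltW.
have h0 n : 0 <= h n by rewrite divr_ge0 ?subr_ge0// ltW.
have w00 : w 0%N = a' - a by rewrite /w expr0 divr1.
have h00 : h 0%N = b' - b by rewrite /h expr0 divr1.
have whW n : w n + h n = ((a' - a) + (b' - b)) / 2 ^+ n by rewrite /w /h -mulrDl.
clearbody w h.
pose D n (z : R * R) := circulation z.1 (z.1 + w n) z.2 (z.2 + h n).
(* The circulations of the four quarters add up to that of the whole, so one of them has at least a
   fourth of its absolute value. *)
have stepP n (z : R * R) : exists z' : R * R,
    [/\ z'.1 = z.1 \/ z'.1 = z.1 + w n.+1,
        z'.2 = z.2 \/ z'.2 = z.2 + h n.+1 &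
        `|D n z| <= 4 * `|D n.+1 z'|].
  case: z => x y /=; set w1 := w n.+1; set h1 := h n.+1.
  have E : D n (x, y) = D n.+1 (x, y) + D n.+1 (x + w1, y) +
      D n.+1 (x, y + h1) + D n.+1 (x + w1, y + h1).
    by rewrite /D /= wS hS -/w1 -/h1 !addrA /circulation; ring.
  apply: contrapT => H.
  have {}H x' y' : x' = x \/ x' = x + w1 -> y' = y \/ y' = y + h1 ->
      4 * `|D n.+1 (x', y')| < `|D n (x, y)|.
    by move=> h1' h2'; rewrite ltNge; apply/negP => h3'; apply: H; exists (x', y').
  have := H x y (or_introl erefl) (or_introl erefl).
  have := H _ y (or_intror erefl) (or_introl erefl).
  have := H x _ (or_introl erefl) (or_intror erefl).
  have := H _ _ (or_intror erefl) (or_intror erefl).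
  have : `|D n (x, y)| <= `|D n.+1 (x, y)| + `|D n.+1 (x + w1, y)| +
      `|D n.+1 (x, y + h1)| + `|D n.+1 (x + w1, y + h1)|.
    rewrite E (le_trans (ler_normD _ _))// lerD2r.
    rewrite (le_trans (ler_normD _ _))// lerD2r.
    exact: ler_normD.
  by lra.
have [step {}stepP] : {step : nat * (R * R) -> R * R & forall nz,
    [/\ (step nz).1 = nz.2.1 \/ (step nz).1 = nz.2.1 + w nz.1.+1,
        (step nz).2 = nz.2.2 \/ (step nz).2 = nz.2.2 + h nz.1.+1 &
        `|D nz.1 nz.2| <= 4 * `|D nz.1.+1 (step nz)|]}.
  apply: (@choice _ _ (fun (nz : nat * (R * R)) (z' : R * R) =>
    [/\ z'.1 = nz.2.1 \/ z'.1 = nz.2.1 + w nz.1.+1,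
        z'.2 = nz.2.2 \/ z'.2 = nz.2.2 + h nz.1.+1 &
        `|D nz.1 nz.2| <= 4 * `|D nz.1.+1 z'|])) => -[n z].
  exact: stepP.
pose s := fix s n := if n is m.+1 then step (m, s m) else (a, b).
have sS n : [/\ (s n.+1).1 = (s n).1 \/ (s n.+1).1 = (s n).1 + w n.+1,
    (s n.+1).2 = (s n).2 \/ (s n.+1).2 = (s n).2 + h n.+1 &
    `|D n (s n)| <= 4 * `|D n.+1 (s n.+1)|] by exact: (stepP (n, s n)).
have s0 : s 0%N = (a, b) by [].
clearbody s.
have D4 n : `|D 0%N (a, b)| <= 4 ^+ n * `|D n (s n)|.
  elim: n => [|n IH]; first by rewrite expr0 mul1r s0.
  rewrite (le_trans IH)// exprSr -mulrA ler_wpM2l ?exprn_ge0//.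
  by have [_ _] := sS n.
have [px Hpx] : exists p, forall n, (s n).1 <= p <= (s n).1 + w n.
  apply: nested_point => // n; have [+ _ _] /= := sS n.
  have := w0 n.+1; have := wS n.
  by move=> -> hw [] ->; split; lra.
have [py Hpy] : exists p, forall n, (s n).2 <= p <= (s n).2 + h n.
  apply: nested_point => // n; have [_ + _] /= := sS n.
  have := h0 n.+1; have := hS n.
  by move=> -> hw [] ->; split; lra.
have sin n : [/\ a <= (s n).1, (s n).1 + w n <= a', b <= (s n).2
   & (s n).2 + h n <= b'].
  elim: n => [|n [i1 i2 i3 i4]].
    by rewrite s0 w00 h00 /= !subrKC; split.
  have [+ + _] /= := sS n; move: i2 i4; rewrite wS hS => i2 i4.
  have := w0 n.+1; have := h0 n.+1.
  by move=> q1 q2 [] -> [] ->; split; lra.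
have D0E : D 0%N (a, b) = circulation a a' b b'.
  by rewrite /D w00 h00 /= !subrKC.
rewrite -D0E; apply/eqP; rewrite -normr_le0; apply/ler_addgt0Pr => e e0.
rewrite add0r.
have pxin : x0 <= px <= x1.
  have [q1 q2 _ _] := sin 0%N; have /andP[q3 q4] := Hpx 0%N.
  by apply/andP; split; lra.
have pyin : y0 <= py <= y1.
  have [_ _ q1 q2] := sin 0%N; have /andP[q3 q4] := Hpy 0%N.
  by apply/andP; split; lra.
have [p [q [r H]]] := cf pxin pyin.
set W := (a' - a) + (b' - b).
have W0 : 0 <= W by rewrite addr_ge0 ?subr_ge0.
(* In the bound of [circulation_small] the half perimeter [W / 2 ^+ n] occurs twice; with this
   tolerance, [4 ^+ n] times the bound is [e * (W ^+ 2 / (W ^+ 2 + 1))], which is at most [e]. *)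
have [|d d0 {}H] := H (e / (2 * (W ^+ 2 + 1))).
  by rewrite divr_gt0// mulr_gt0// ltr_wpDl ?sqr_ge0.
have [n Wn] : exists n, W / 2 ^+ n < d.
  have [n /andP[_ nP]] : exists n, true && (W / d < n%:R).
    exists (Num.bound (W / d)); rewrite /=.
    by apply: archi_boundP; rewrite divr_ge0// ltW.
  exists n; rewrite ltr_pdivrMr// mulrC -ltr_pdivrMr// (lt_trans nP)//.
  by rewrite -natrX ltr_nat ltn_expl.
have [q1 q2 q3 q4] := sin n.
have /andP[q5 q6] := Hpx n; have /andP[q7 q8] := Hpy n.
have [w0n h0n] := (w0 n, h0 n).
have := D4 n; rewrite /D.
clear D4 D0E stepP step sS sin Hpx Hpy w00 h00 wS hS w0 h0.
have : `|circulation (s n).1 ((s n).1 + w n) (s n).2 ((s n).2 + h n)| <=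
    2 * (e / (2 * (W ^+ 2 + 1)) * (W / 2 ^+ n)) *
      ((s n).1 + w n - (s n).1 + ((s n).2 + h n - (s n).2)).
  apply: (@circulation_small p q r (v px py) (u px py) px py); try by clear H Wn W0; lra.
  move=> x y /andP[x1' x2'] /andP[y1' y2'].
  have xpx : `|x - px| <= w n.
    by clear H Wn W0; rewrite ler_norml; apply/andP; split; lra.
  have ypy : `|y - py| <= h n.
    by clear H Wn W0; rewrite ler_norml; apply/andP; split; lra.
  have whd : w n + h n < d by rewrite whW.
  have [||||k1 k2] := H x y.
  - by clear H Wn W0; apply/andP; split; lra.
  - by clear H Wn W0; apply/andP; split; lra.
  - by clear H Wn W0; lra.
  - by clear H Wn W0; lra.
  have c0 : 0 <= e / (2 * (W ^+ 2 + 1)).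
    by rewrite divr_ge0 ?mulr_ge0 ?addr_ge0 ?sqr_ge0// ltW.
  by split; [apply: le_trans k1 _|apply: le_trans k2 _];
     rewrite ler_wpM2l// -whW lerD.
have -> : (s n).1 + w n - (s n).1 + ((s n).2 + h n - (s n).2) = W / 2 ^+ n.
  by rewrite -whW; ring.
set c := `|_|; set c' := `|_| => cb c'b.
rewrite (_ : e = 4 ^+ n * (e / 4 ^+ n)); last first.
  by rewrite mulrC divfK// gt_eqF// exprn_gt0.
apply: le_trans c'b _; rewrite ler_pM2l ?exprn_gt0//; apply: le_trans cb _.
have -> : 2 * (e / (2 * (W ^+ 2 + 1)) * (W / 2 ^+ n)) * (W / 2 ^+ n) =
    (e / 4 ^+ n) * (W ^+ 2 / (W ^+ 2 + 1)).
  have -> : (4 : R) ^+ n = 2 ^+ n * 2 ^+ n by rewrite -exprMn; congr (_ ^+ _); ring.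
  have nW : W ^+ 2 + 1 != 0 by rewrite gt_eqF// ltr_wpDl ?sqr_ge0.
  have n2 : (2 : R) ^+ n != 0 by rewrite gt_eqF.
  by field; rewrite nW n2.
apply: ler_piMr; first by rewrite divr_ge0 ?exprn_ge0// ltW.
have W1 : 0 < W ^+ 2 + 1 by rewrite ltr_wpDl ?sqr_ge0.
by rewrite ler_pdivrMr// mul1r lerDl.
Qed.

(** [G] integrates along the height [y0] and then vertically. Goursat's theorem on the rectangle
    between the heights [y0] and [y] turns its increment into the integral along the path from
    [(x, y)] through [(x', y)] to [(x', y')]. *)
Lemma potential_increment x x' y y' :
  x0 <= x <= x1 -> x0 <= x' <= x1 -> y0 <= y <= y1 -> y0 <= y' <= y1 ->
  let G a b := V y0 a + (U a b - U a y0) in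
  G x' y' - G x y = (V y x' - V y x) + (U x' y' - U x' y).
Proof.
move=> /andP[x0x xx1] /andP[x0x' x'x1] /andP[y0y yy1] _ /=.
have [xx'|/ltW x'x] := leP x x'.
  have := goursat_rectangle xx' y0y x0x x'x1 (lexx _) yy1.
  by rewrite /circulation; lra.
have := goursat_rectangle x'x y0y x0x' xx1 (lexx _) yy1.
by rewrite /circulation; lra.
Qed.

End Rectangle.

Lemma primitive_increment (R : realType) (F f : R -> R) (a b c eta : R) :
  (forall x, Num.min a b <= x <= Num.max a b ->
     is_derive x 1 F (f x) /\ `|f x - c| <= eta) ->
  `|F b - F a - c * (b - a)| <= eta * `|b - a|.
Proof.
wlog ab : a b / a <= b.
  move=> wh H; have [/wh|/ltW ba] := leP a b; first by apply.
  rewrite (_ : F b - F a - c * (b - a) = - (F a - F b - c * (a - b))); last by ring.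
  rewrite normrN.
  by rewrite (distrC b a); apply: wh => // x; rewrite minC maxC; exact: H.
rewrite min_l// max_r// [`|b - a|]ger0_norm ?subr_ge0// => H.
have := @primitive_near_affine R F f a b c 0 0 eta ab.
rewrite !mul0r addr0; apply.
  by move=> x /H[].
by move=> x /H[_]; rewrite mul0r addr0.
Qed.

(** The increment of the potential is an integral over one horizontal and one vertical segment, on
    which [v] and [u] stay within [e] of their values at [(x, y)]. The conclusion says that [G] has
    differential [v dx + u dy] relative to the rectangle. *)
Lemma closed_form_potential (R : realType) (u v : R -> R -> R) (x0 x1 y0 y1 : R) :
  x0 <= x1 -> y0 <= y1 -> closed_form_on u v x0 x1 y0 y1 ->
  exists G : R -> R -> R, forall x y, x0 <= x <= x1 -> y0 <= y <= y1 ->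
  forall e : R, 0 < e -> exists2 d : R, 0 < d &
  forall x' y', x0 <= x' <= x1 -> y0 <= y' <= y1 ->
    `|x' - x| < d -> `|y' - y| < d ->
    `|G x' y' - G x y - (v x y * (x' - x) + u x y * (y' - y))| <=
      e * (`|x' - x| + `|y' - y|).
Proof.
move=> x01 y01 cf; have [V [U [HV HU]]] := closed_form_primitives cf x01 y01.
exists (fun a b => V y0 a + (U a b - U a y0)) => x y hx hy e e0.
have [d d0 H] := closed_form_continuous cf hx hy e0.
exists d => // x' y' hx' hy' xd yd.
rewrite (potential_increment cf HV HU hx hx' hy hy').
rewrite (_ : V y x' - V y x + (U x' y' - U x' y) -
    (v x y * (x' - x) + u x y * (y' - y)) =
  (V y x' - V y x - v x y * (x' - x)) +
  (U x' y' - U x' y - u x y * (y' - y))); last by ring.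
have btw (a b z : R) : Num.min a b <= z <= Num.max a b ->
    `|z - a| <= `|b - a| /\ (forall l r, l <= a <= r -> l <= b <= r -> l <= z <= r).
  case: (leP a b) => ab /andP[z1 z2]; split.
  - by rewrite !ger0_norm ?subr_ge0// lerD2r.
  - by move=> l r /andP[p1 p2] /andP[p3 p4]; apply/andP; split; lra.
  - by have ba := ltW ab; rewrite !ler0_norm ?subr_le0//; lra.
  - by move=> l r /andP[p1 p2] /andP[p3 p4]; apply/andP; split; lra.
apply: le_trans (ler_normD _ _) _; rewrite [e * _]mulrDr; apply: lerD.
  apply: (@primitive_increment _ _ (v ^~ y)) => z /btw[zx zin].
  have hz := zin _ _ hx hx'; split; first exact: HV.
  by have [] := H z y hz hy (le_lt_trans zx xd) (ltac:(by rewrite subrr normr0)).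
apply: (@primitive_increment _ _ (u x')) => z /btw[zy zin].
have hz := zin _ _ hy hy'; split; first exact: HU.
by have [] := H x' z hx' hz xd (le_lt_trans zy yd).
Qed.

(** * One complex variable *)

(** This form has no division, so [h = 0] is no exception and any increment can be substituted for
    [h]. *)
Lemma is_deriveP (K : numFieldType) (f : K -> K) (z c : K) :
  is_derive z 1 f c <->
  forall e : K, 0 < e -> exists2 d : K, 0 < d &
    forall h, `|h| < d -> `|f (z + h) - f z - c * h| <= e * `|h|.
Proof.
have E h : h != 0 -> `|h^-1 *: (f (h *: 1 + z) - f z) - c| =
    `|h|^-1 * `|f (z + h) - f z - c * h|.
  move=> h0; rewrite -normfV -normrM [h *: 1]mulr1 (addrC h).
  by congr `|_|; rewrite /GRing.scale /=; field.
split=> [[fd fc] e e0|H].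
  have {fd fc} fc : h^-1 *: (f (h *: 1 + z) - f z) @[h --> 0^'] --> c.
    by rewrite -fc; exact: fd.
  have /cvgrPdist_le /(_ e e0) /nbhs_ballP[d /= d0 H] := fc.
  exists d => // h hd; have [->|h0] := eqVneq h 0.
    by rewrite addr0 subrr mulr0 subr0 normr0 mulr0.
  have := H h; rewrite -ball_normE /= sub0r normrN => /(_ hd h0).
  by rewrite distrC /= E// mulrC ler_pdivrMr ?normr_gt0.
suff fc : h^-1 *: (f (h *: 1 + z) - f z) @[h --> 0^'] --> c.
  by apply: DeriveDef; [apply/cvg_ex; exists c|exact: cvg_lim].
apply/cvgrPdist_le => e e0; have [d d0 {}H] := H e e0.
apply/nbhs_ballP; exists d => //= h; rewrite -ball_normE /= sub0r normrN => hd h0.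
by rewrite distrC /= E// mulrC ler_pdivrMr ?normr_gt0// H.
Qed.

(** * The modulus of a complex number as a real number *)

Section ComplexNorm.
Variable R : realType.
Notation K := (Cplx R).
Implicit Types z w : K.

Lemma normrC z : `|z| = (normc z)%:C%C. Proof. by case: z. Qed.

Lemma normc_ge0 z : 0 <= normc z :> R. Proof. by case: z => x y; exact: sqrtr_ge0. Qed.

Lemma normcC (x : R) : normc x%:C%C = `|x|.
Proof. by rewrite /normc /= expr0n addr0 sqrtr_sqr. Qed.

Lemma normc_eq0 z : (normc z == 0) = (z == 0).
Proof. by apply/eqP/eqP => [/eq0_normc//|->]; rewrite normc0. Qed.

Lemma normc_gt0 z : (0 < normc z) = (z != 0).
Proof. by rewrite lt_def normc_ge0 andbT normc_eq0. Qed.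

Lemma normcB z w : normc (z - w) = normc (w - z).
Proof. by rewrite -normcN opprB. Qed.

Lemma sqr_normc_re_im z : normc z ^+ 2 = complex.Re z ^+ 2 + complex.Im z ^+ 2.
Proof. by case: z => x y; rewrite /normc sqr_sqrtr// addr_ge0 ?sqr_ge0. Qed.

Lemma abs_re_le z : `|complex.Re z| <= normc z.
Proof. by rewrite -lecR -normrC; exact: normc_ge_Re. Qed.

Lemma abs_im_le z : `|complex.Im z| <= normc z.
Proof.
rewrite -(@ler_pXn2r _ 2) ?nnegrE ?normc_ge0// sqr_normc_re_im real_normK ?num_real//.
by rewrite lerDr sqr_ge0.
Qed.

Lemma normc_le_re_im z : normc z <= `|complex.Re z| + `|complex.Im z|.
Proof.
rewrite -(@ler_pXn2r _ 2) ?nnegrE ?normc_ge0 ?addr_ge0// sqr_normc_re_im sqrrD.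
rewrite !real_normK ?num_real// addrAC lerDl mulrn_wge0// mulr_ge0//.
Qed.

Lemma ReCD z w : complex.Re (z + w) = complex.Re z + complex.Re w.
Proof. by case: z w => ? ? []. Qed.
Lemma ImCD z w : complex.Im (z + w) = complex.Im z + complex.Im w.
Proof. by case: z w => ? ? []. Qed.
Lemma ReCN z : complex.Re (- z) = - complex.Re z. Proof. by case: z. Qed.
Lemma ImCN z : complex.Im (- z) = - complex.Im z. Proof. by case: z. Qed.
Lemma ReCM z w : complex.Re (z * w) =
  complex.Re z * complex.Re w - complex.Im z * complex.Im w.
Proof. by case: z w => ? ? []. Qed.
Lemma ImCM z w : complex.Im (z * w) =
  complex.Re z * complex.Im w + complex.Im z * complex.Re w.
Proof. by case: z w => ? ? [? ?]. Qed.

(** A positive element of [K] is real, so real radii suffice; this moves the estimates from [K] to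
    [R]. *)
Lemma nbhsC (z : K) (A : set K) : nbhs z A <->
  exists2 d : R, 0 < d & forall w, normc (w - z) < d -> A w.
Proof.
split=> [/nbhs_ballP[e /= e0 H]|[d d0 H]].
  have eE : e = (complex.Re e)%:C%C by rewrite RRe_real// gtr0_real.
  exists (complex.Re e); first by rewrite -ltcR -eE.
  move=> w wz; apply: H; rewrite -ball_normE /= distrC.
  by rewrite normrC eE ltcR.
apply/nbhs_ballP; exists d%:C%C; first by rewrite /= ltcR.
by move=> w; rewrite -ball_normE /= distrC normrC ltcR; exact: H.
Qed.

Lemma is_deriveCP (f : K -> K) (z c : K) :
  is_derive z 1 f c <->
  forall e : R, 0 < e -> exists2 d : R, 0 < d &
    forall h, normc h < d -> normc (f (z + h) - f z - c * h) <= e * normc h.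
Proof.
split=> [/is_deriveP H e e0|H].
  have [|d d0 {}H] := H e%:C%C; first by rewrite ltcR.
  have dE : d = (complex.Re d)%:C%C by rewrite RRe_real// gtr0_real.
  exists (complex.Re d); first by rewrite -ltcR -dE.
  move=> h hd; have := H h; rewrite !normrC dE ltcR => /(_ hd).
  by rewrite -rmorphM /= lecR.
apply/is_deriveP => e e0.
have eE : e = (complex.Re e)%:C%C by rewrite RRe_real// gtr0_real.
have [|d d0 {}H] := H (complex.Re e); first by rewrite -ltcR -eE.
exists d%:C%C; first by rewrite ltcR.
by move=> h; rewrite !normrC ltcR => /H; rewrite eE -rmorphM /= lecR.
Qed.

End ComplexNorm.

Lemma is_derive_estimate (R : realType) (f : R -> R) (x c : R) :
  is_derive x 1 f c -> forall e : R, 0 < e -> exists2 d : R, 0 < d &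
    forall h, `|h| < d -> `|f (x + h) - f x - c * h| <= e * `|h|.
Proof. by move=> /is_deriveP. Qed.

(** * The exponential as polar coordinates *)

Section Polar.
Variable R : realType.
Notation K := (Cplx R).

Definition cexp (x y : R) : K := ((expR x * cos y) +i* (expR x * sin y))%C.

Lemma cexpD x y s t : cexp (x + s) (y + t) = cexp x y * cexp s t.
Proof.
apply/eqP; rewrite eq_complex /cexp/= expRD cosD sinD.
by apply/andP; split; apply/eqP; ring.
Qed.

Lemma normc_cexp x y : normc (cexp x y) = expR x.
Proof.
by rewrite /normc /cexp /= !exprMn -mulrDr cos2Dsin2 mulr1 sqrtr_sqr ger0_norm ?expR_ge0.
Qed.

Lemma cexp_near0 (e : R) : 0 < e -> exists2 d : R, 0 < d & forall s t,
  `|s| < d -> `|t| < d ->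
  normc (cexp s t - 1 - (s +i* t)%C) <= e * (`|s| + `|t|).
Proof.
(* The errors in the real and imaginary parts add up to at most [e1] times the modulus of [s] plus
   [8 * e1] times that of [t]. The condition [e1 <= 1] serves the crude bounds on [expR s] and
   [sin t]. *)
move=> e0; pose e1 := Num.min (e / 8) 1.
have e10 : 0 < e1 by rewrite lt_min divr_gt0//= ltr01.
have e1e : 8 * e1 <= e by rewrite mulrC -ler_pdivlMr// ge_min lexx.
have e11 : e1 <= 1 by rewrite ge_min lexx orbT.
clearbody e1.
have [d1 d10 H1] := is_derive_estimate (is_derive_expR (0 : R)) e10.
have [d2 d20 H2] := is_derive_estimate (is_derive_cos (0 : R)) e10.
have [d3 d30 H3] := is_derive_estimate (is_derive_sin (0 : R)) e10.
exists (Num.min (Num.min e1 d1) (Num.min d2 d3)).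
  by rewrite !lt_min e10 d10 d20 d30.
move=> s t; rewrite !lt_min => /andP[/andP[se1 sd1] _].
move=> /andP[/andP[te1 td1] /andP[td2 td3]].
have {H1} := H1 s sd1; rewrite add0r expR0 mul1r => H1.
have {H2} := H2 t td2; rewrite add0r cos0 sin0 oppr0 mul0r subr0 => H2.
have {H3} := H3 t td3; rewrite add0r sin0 cos0 mul1r subr0 => H3.
have s0 := normr_ge0 s; have t0 := normr_ge0 t.
have es1 : `|expR s - 1| <= 2 * `|s|.
  rewrite -(subrK s (expR s - 1)) (le_trans (ler_normD _ _))//.
  have : e1 * `|s| <= `|s| by rewrite ler_piMl.
  by lra.
have es : `|expR s| <= 3.
  rewrite -(subrK 1 (expR s)) (le_trans (ler_normD _ _))// normr1.
  by lra.
have st : `|sin t| <= 2 * `|t|.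
  rewrite -(subrK t (sin t)) (le_trans (ler_normD _ _))//.
  have : e1 * `|t| <= `|t| by rewrite ler_piMl.
  by lra.
have k1 : `|expR s * (cos t - 1)| <= 3 * (e1 * `|t|).
  by rewrite normrM ler_pM.
have k2 : `|(expR s - 1) * sin t| <= 2 * e1 * (2 * `|t|).
  rewrite normrM ler_pM//; lra.
apply: le_trans (normc_le_re_im _) _ => /=.
have -> : expR s * cos t - 1 - s = (expR s - 1 - s) + expR s * (cos t - 1) by ring.
have -> : expR s * sin t - 0 - t = (sin t - t) + (expR s - 1) * sin t by ring.
apply: le_trans (lerD (ler_normD _ _) (ler_normD _ _)) _.
have : 8 * e1 * (`|s| + `|t|) <= e * (`|s| + `|t|).
  by rewrite ler_wpM2r// addr_ge0.
have : 0 <= e1 * `|s| by rewrite mulr_ge0// ltW.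
have : 0 <= e1 * `|t| by rewrite mulr_ge0// ltW.
have kE : 2 * e1 * (2 * `|t|) = 4 * (e1 * `|t|) by ring.
rewrite {}kE in k2; rewrite -mulrA mulrDr.
move: H1 H2 H3 k1 k2; set A := e1 * `|s|; set B := e1 * `|t|.
by clear; lra.
Qed.

(** Chain rule for [f] after the exponential, whose derivative is the exponential itself; hence the
    factor [c * cexp x y]. *)
Lemma polar_estimate (f : K -> K) (c : K) (x y : R) :
  is_derive (cexp x y) 1 f c -> forall e : R, 0 < e -> exists2 d : R, 0 < d &
  forall s t, `|s| < d -> `|t| < d ->
  normc (f (cexp (x + s) (y + t)) - f (cexp x y) -
    c * cexp x y * (s +i* t)%C) <= e * (`|s| + `|t|).
Proof.
move=> fc e e0; set E := cexp x y.
pose M := expR x * 2; have M0 : 0 < M by rewrite mulr_gt0 ?expR_gt0.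
pose C := normc c * expR x + 1.
have C0 : 0 < C by rewrite ltr_wpDl// mulr_ge0 ?normc_ge0 ?expR_ge0.
have [|d1 d10 H1] := (is_deriveCP f E c).1 fc (e / 2 / M).
  by rewrite !divr_gt0.
have [|d2 d20 H2] := @cexp_near0 (Num.min 1 (e / 2 / C)).
  by rewrite lt_min ltr01 !divr_gt0.
exists (Num.min d2 (d1 / M / 2)); first by rewrite lt_min d20 !divr_gt0.
move=> s t; rewrite !lt_min => /andP[sd2 sd1] /andP[td2 td1].
have {}H2 := H2 s t sd2 td2.
have S0 : 0 <= `|s| + `|t| by rewrite addr_ge0.
have H2a := le_trans H2 (ler_wpM2r S0 (_ : Num.min 1 (e / 2 / C) <= 1)).
have {}H2a := H2a (ltac:(by rewrite ge_min lexx)).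
have H2b := le_trans H2 (ler_wpM2r S0 (_ : Num.min 1 (e / 2 / C) <= e / 2 / C)).
have {}H2b := H2b (ltac:(by rewrite ge_min lexx orbT)).
set r := cexp s t - 1 - _ in H2 H2a H2b.
set w : K := (s +i* t)%C in r H2 H2a H2b *.
have wS : normc w <= `|s| + `|t| by exact: normc_le_re_im.
have EE : cexp (x + s) (y + t) = E + E * (w + r).
  by rewrite cexpD -/E /r; ring.
have nE : normc (E * (w + r)) <= M * (`|s| + `|t|).
  rewrite normcM normc_cexp /M -mulrA ler_wpM2l ?expR_ge0//.
  by rewrite (le_trans (le_normcD _ _))// mulrDl !mul1r lerD// -[leRHS]mul1r.
have := H1 (E * (w + r)); rewrite -EE.
have -> : normc (E * (w + r)) < d1.
  rewrite (le_lt_trans nE)// mulrC -ltr_pdivlMr//.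
  by lra.
move=> /(_ isT) {}H1.
have -> : f (cexp (x + s) (y + t)) - f E - c * E * w =
    (f (cexp (x + s) (y + t)) - f E - c * (E * (w + r))) + c * E * r by ring.
apply: le_trans (le_normcD _ _) _.
have -> : e * (`|s| + `|t|) = e / 2 / M * (M * (`|s| + `|t|)) +
   C * (e / 2 / C * (`|s| + `|t|)) by field; rewrite !gt_eqF.
apply: lerD.
  by apply: le_trans H1 _; rewrite ler_wpM2l// ltW// !divr_gt0.
rewrite normcM; apply: ler_pM => //; try exact: normc_ge0.
by rewrite normcM normc_cexp /C lerDl.
Qed.

End Polar.

(** * Mean value property and maximum principle on a circle *)

Section MeanValue.
Variable R : realType.
Notation K := (Cplx R).
Implicit Types f : K -> K.

(** With [z = x + i y], the form is the imaginary part of [f (exp z) dz], and the Cauchy-Riemann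
    equations for [f (exp z)] say that it is closed; [k] is the derivative of that function. *)
Lemma polar_closed_form f (x0 x1 y0 y1 : R) :
  (forall x y, x0 <= x <= x1 -> derivable f (cexp x y) 1) ->
  closed_form_on (fun x y => complex.Re (f (cexp x y)))
    (fun x y => complex.Im (f (cexp x y))) x0 x1 y0 y1.
Proof.
move=> fd x y hx hy; have /derivableP fc := fd x y hx; move: fc; set c := 'D_1 f _ => fc.
pose k := c * cexp x y; exists (complex.Im k), (complex.Re k), (- complex.Im k).
move=> e e0; have [d d0 H] := polar_estimate fc e0.
exists d => // x' y' _ _ hx' hy'; have := H _ _ hx' hy'.
rewrite -/k !subrKC => {}H; split.
  apply: le_trans H; apply: le_trans (abs_im_le _).
  by rewrite !(ImCD, ImCN) ImCM /= [complex.Re k * _ + _]addrC.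
apply: le_trans H; apply: le_trans (abs_re_le _).
by rewrite !(ReCD, ReCN) ReCM /= mulNr.
Qed.

Lemma primitive_unique (F G h : R -> R) (a b : R) : a <= b ->
  (forall x, a <= x <= b -> is_derive x 1 F (h x)) ->
  (forall x, a <= x <= b -> is_derive x 1 G (h x)) ->
  F b - F a = G b - G a.
Proof.
move=> ab HF HG; apply/eqP; rewrite -subr_eq0; apply/eqP.
have HFG x : a <= x <= b -> is_derive x 1 (F - G) 0.
  by move=> xab; have := is_deriveB (HF x xab) (HG x xab); rewrite subrr.
have := @primitive_near_affine R (F - G) (cst 0) a b 0 0 0 0 ab HFG.
have H0 : forall x : R, a <= x <= b -> `|cst 0 x - (0 + 0 * (x - 0))| <= 0.
  by move=> x _; rewrite /cst /= !mul0r addr0 subrr normr0.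
move=> /(_ H0); rewrite !mul0r addr0 subr0 normr_le0 !fctE => /eqP FG0.
by rewrite -FG0; ring.
Qed.

(* The mean of [Re f] over circles centred at 0 does not depend on the radius:
   in the coordinates [exp (x + i y)] this is Goursat's theorem on a rectangle
   of height [2 pi], whose horizontal sides cancel by periodicity. *)
Lemma circle_mean f :
  (forall z : K, normc z <= 1 -> derivable f z 1) ->
  exists2 U : R -> R,
    forall y : R, 0 <= y <= pi *+ 2 -> is_derive y 1 U (complex.Re (f (cexp 0 y))) &
    U (pi *+ 2) - U 0 = complex.Re (f 0) * (pi *+ 2).
Proof.
move=> fd; have p0 : 0 <= pi *+ 2 :> R by rewrite mulrn_wge0// pi_ge0.
have fdE (x y : R) : x <= 0 -> derivable f (cexp x y) 1.
  by move=> x0; apply: fd; rewrite normc_cexp -expR0 ler_expR.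
pose u (x y : R) := complex.Re (f (cexp x y)).
pose v (x y : R) := complex.Im (f (cexp x y)).
have cont (e : R) : 0 < e -> exists2 d : R, 0 < d & forall z : K, normc z < d ->
    `|complex.Re (f z) - complex.Re (f 0)| <= e.
  move=> e0; have /derivableP := fd 0 (ltac:(by rewrite normc0)); set c := 'D_1 f _ => fc.
  have [d d0 H] := (is_deriveCP f 0 c).1 fc 1 ltr01.
  exists (Num.min d (e / (normc c + 1))).
    by rewrite lt_min d0 divr_gt0// ltr_wpDl// normc_ge0.
  move=> z; rewrite lt_min => /andP[/H]; rewrite add0r mul1r => {}H zc.
  rewrite -ReCN -ReCD; apply: le_trans (abs_re_le _) _.
  rewrite -(subrK (c * z) (f z - f 0)).
  apply: le_trans (le_normcD _ _) _; rewrite normcM.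
  move: zc; rewrite ltr_pdivlMr ?ltr_wpDl ?normc_ge0// => zc.
  apply: le_trans (lerD H (lexx _)) _.
  by rewrite mulrC -[X in X + _]mulr1 -mulrDr addrC ltW.
have main (x0 : R) : x0 <= 0 -> exists U U0 : R -> R,
   [/\ forall y : R, 0 <= y <= pi *+ 2 -> is_derive y 1 U (u 0 y),
       forall y : R, 0 <= y <= pi *+ 2 -> is_derive y 1 U0 (u x0 y) &
       U (pi *+ 2) - U 0 = U0 (pi *+ 2) - U0 0].
  move=> x00.
  have cf : closed_form_on u v x0 0 0 (pi *+ 2).
    by apply: polar_closed_form => x y /andP[_]; exact: fdE.
  have [V [U [HV HU]]] := closed_form_primitives cf x00 p0.
  have x0in : x0 <= x0 <= 0 by rewrite lexx x00.
  have x1in : x0 <= (0 : R) <= 0 by rewrite x00 /=.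
  have y0in : (0 : R) <= 0 <= (pi *+ 2 : R) by rewrite lexx p0.
  have y1in : (0 : R) <= pi *+ 2 <= (pi *+ 2 : R) by rewrite p0 /=.
  exists (U 0), (U x0); split; [by move=> y; apply: HU|by move=> y; apply: HU|].
  have := goursat_rectangle cf HV HU x00 p0 (lexx _) (lexx _) (lexx _) (lexx _).
  rewrite /circulation => H.
  have : V 0 0 - V 0 x0 = V (pi *+ 2) 0 - V (pi *+ 2) x0.
    apply: (@primitive_unique (V 0) (V (pi *+ 2)) (v ^~ 0) x0 0 x00) => x hx.
      exact: HV.
    have -> : v x 0 = v x (pi *+ 2) by rewrite /v /cexp cos2pi sin2pi cos0 sin0.
    exact: HV.
  by move: H; lra.
have [U [_ [HU _ _]]] := main 0 (lexx _).
exists U => //; apply/eqP; rewrite -subr_eq0 -normr_le0.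
apply/ler_addgt0Pr => e e0; rewrite add0r.
pose e1 := e / (pi *+ 2 + 1).
have e10 : 0 < e1 by rewrite divr_gt0// ltr_wpDl.
have [d d0 Hd] := cont e1 e10.
(* The exponential never reaches 0, so a circle of radius [expR x0 < d] stands for the center: on it
   the real part of [f] is within [e1] of its value at 0. The primitive [U'] obtained for this [x0]
   has the same derivative as [U], hence the same increment. *)
pose x0 := Num.min 0 (ln (d / 2)).
have x00 : x0 <= 0 by rewrite ge_min lexx.
have x0d : expR x0 < d.
  apply: (@le_lt_trans _ _ (d / 2)); last by lra.
  rewrite -[leRHS]lnK ?posrE ?divr_gt0// ler_expR.
  by rewrite ge_min lexx orbT.
have [U' [U0 [HU' HU0 E]]] := main x0 x00.
rewrite (primitive_unique p0 HU HU') E.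
have := @primitive_near_affine R U0 (u x0) 0 (pi *+ 2) (complex.Re (f 0)) 0 0 e1 p0 HU0.
have H y : 0 <= y <= pi *+ 2 ->
    `|u x0 y - (complex.Re (f 0) + 0 * (y - 0))| <= e1.
  by move=> _; rewrite mul0r addr0; apply: Hd; rewrite normc_cexp.
move=> /(_ H); rewrite !mul0r addr0 subr0 => /le_trans; apply.
rewrite /e1 mulrAC ler_pdivrMr ?ltr_wpDl// ler_wpM2l ?lerDl// ltW//.
Qed.

Lemma cexp_pi : cexp 0 (pi : R) = -1.
Proof. by apply/eqP; rewrite eq_complex /= expR0 cospi sinpi !mul1r oppr0 !eqxx. Qed.

(** [g] is a primitive of a nonnegative function, so it is nondecreasing, and by the mean value
    property it has equal values at 0 and [pi *+ 2]. It is therefore constant, and its derivative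
    vanishes at the interior point [pi], which corresponds to the point -1 of the circle. *)
Lemma mean_value_max f :
  (forall z : K, normc z <= 1 -> derivable f z 1) ->
  (forall y : R, 0 <= y <= pi *+ 2 ->
    complex.Re (f (cexp 0 y)) <= complex.Re (f 0)) ->
  complex.Re (f (-1)) = complex.Re (f 0).
Proof.
move=> fd fle; have [U HU UE] := circle_mean fd.
pose m := complex.Re (f 0).
pose g := (m *: id - U) : R -> R.
have p0 : 0 < pi :> R := pi_gt0 R.
have gd y : 0 <= y <= pi *+ 2 -> is_derive y 1 g (m - complex.Re (f (cexp 0 y))).
  move=> /HU dU; have := is_deriveB (is_deriveZ m (is_derive_id y 1)) dU.
  by rewrite [m *: _]mulr1.
have gmono y y' : 0 <= y -> y <= y' -> y' <= pi *+ 2 -> g y <= g y'.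
  move=> y0 yy' y'p; rewrite -subr_ge0.
  have sub z : y <= z <= y' -> 0 <= z <= pi *+ 2.
    by move=> /andP[a b]; rewrite (le_trans y0 a) (le_trans b y'p).
  have [|z zin ->] := @MVT_segment _ g
      (fun y => m - complex.Re (f (cexp 0 y))) y y' yy' _
      (is_derive_within (fun z hz => gd z (sub z hz))).
    by move=> z; rewrite in_itv /= => /andP[a b]; apply/gd/sub; rewrite !ltW.
  by rewrite mulr_ge0 ?subr_ge0// fle// sub.
have gE : g (pi *+ 2) = g 0.
  rewrite /g !fctE /GRing.scale /= mulr0 sub0r -/m.
  have := UE; rewrite -/m; lra.
have gmax : is_derive (pi : R) 1 g 0.
  apply: (@derive1_at_max _ g 0 (pi *+ 2)).
  - by rewrite mulrn_wge0// ltW.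
  - by move=> t; rewrite in_itv /= => /andP[/ltW a /ltW b]; have [] := gd t (ltac:(by rewrite a b)).
  - by rewrite in_itv /= p0 mulr2n ltrDl.
  - move=> t; rewrite in_itv /= => /andP[/ltW a /ltW b].
    rewrite (le_trans (gmono t _ a b (lexx _)))// gE gmono//; first exact: ltW.
    by rewrite mulr2n lerDl ltW.
have [|_ h1] := gd (pi : R); first by rewrite ltW//= mulr2n lerDl ltW.
by have [_ h2] := gmax; move: h2; rewrite h1 cexp_pi -/m => /eqP; rewrite subr_eq0 => /eqP.
Qed.

Lemma derivableC f (z : K) : derivable f z 1 <-> differentiable f z.
Proof. exact: derivable1_diffP. Qed.

Lemma differentiable_affine (p q w : K) : differentiable (fun z : K => p + q * z) w.
Proof.
have -> : (fun z : K => p + q * z) = cst p + q *: (id : K -> K) by [].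
apply: differentiableD; first exact: differentiable_cst.
by apply: differentiableZ; exact: ex_diff.
Qed.

(** After multiplication by the conjugate [b] of [f a], the real part takes its largest value, the
    square of [normc (f a)], at the center. The equality at [a - r] and the bound on
    [normc (f (a - r))] give a nonpositive squared modulus of [f (a - r) - f a]. As [r] is any
    complex number, [a - r] is any point of the circle. *)
Lemma max_modulus_circle f (a r : K) :
  (forall z : K, normc (z - a) <= normc r -> derivable f z 1) ->
  (forall y : R, 0 <= y <= pi *+ 2 ->
    normc (f (a + r * cexp 0 y)) <= normc (f a)) ->
  f (a - r) = f a.
Proof.
move=> fd fle; pose b : K := conjc (f a).
pose g (z : K) : K := b * f (a + r * z).
have gd (z : K) : normc z <= 1 -> derivable g z 1.
  move=> z1; have /derivableC fdz : derivable f (a + r * z) 1.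
    by apply: fd; rewrite addrAC subrr add0r normcM ler_piMr// normc_ge0.
  apply/derivableC.
  have -> : g = (fun z : K => 0 + b * z) \o (f \o (fun z : K => a + r * z)).
    by apply/funext => t; rewrite /g /= add0r.
  apply: differentiable_comp; last exact: differentiable_affine.
  by apply: differentiable_comp; [exact: differentiable_affine|exact: fdz].
have g0 : complex.Re (g 0) = normc (f a) ^+ 2.
  rewrite /g mulr0 addr0 sqr_normc_re_im /b ReCM.
  by case: (f a) => p q /=; ring.
have gz (z : K) : complex.Re (g z) <= normc (f a) * normc (f (a + r * z)).
  rewrite (le_trans (ler_norm _))// (le_trans (abs_re_le _))//.
  by rewrite normcM /b; case: (f a) => p q /=; rewrite sqrrN.
have := mean_value_max gd; rewrite g0.
have H (y : R) : 0 <= y <= pi *+ 2 ->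
    complex.Re (g (cexp 0 y)) <= normc (f a) ^+ 2.
  by move=> y0; rewrite (le_trans (gz _))// expr2 ler_wpM2l ?normc_ge0// fle.
move=> /(_ H); rewrite /g mulrN1 => E.
apply/eqP; rewrite -subr_eq0 -normc_eq0 -sqrf_eq0.
have F1 : normc (f (a - r)) <= normc (f a).
  have <- : a + r * cexp 0 pi = a - r.
    by rewrite cexp_pi mulrN1.
  by apply: fle; rewrite pi_ge0 mulr2n lerDl pi_ge0.
have {F1} F1 : normc (f (a - r)) ^+ 2 <= normc (f a) ^+ 2.
  by rewrite ler_pXn2r ?nnegrE ?normc_ge0.
move: E F1; rewrite !sqr_normc_re_im ReCM /b !(ReCD, ImCD, ReCN, ImCN).
case: (f a) => p q /=; case: (f (a - r)) => s t /= E F1.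
rewrite eq_le addr_ge0 ?sqr_ge0// andbT.
rewrite (_ : _ + _ = s ^+ 2 + t ^+ 2 - (p * s - - q * t) *+ 2 + (p ^+ 2 + q ^+ 2)).
  by rewrite E; lra.
by rewrite mulr2n; ring.
Qed.

(** If the center exceeded [M], it would dominate the circle, so [f (a - r)] would equal [f a],
    although it is bounded by [M]. *)
Lemma max_modulus_center f (a r : K) (M : R) :
  (forall z : K, normc (z - a) <= normc r -> derivable f z 1) ->
  (forall y : R, 0 <= y <= pi *+ 2 -> normc (f (a + r * cexp 0 y)) <= M) ->
  normc (f a) <= M.
Proof.
move=> fd fM; rewrite leNgt; apply/negP => Ma.
have := max_modulus_circle fd (fun y hy => ltW (le_lt_trans (fM y hy) Ma)).
move=> E; have := fM pi (ltac:(by rewrite pi_ge0 mulr2n lerDl pi_ge0)).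
by rewrite cexp_pi mulrN1 E leNgt Ma.
Qed.

Lemma circle_bounded f (a r : K) :
  (forall z : K, normc (z - a) <= normc r -> derivable f z 1) ->
  exists M : R, forall y : R, 0 <= y <= pi *+ 2 ->
    normc (f (a + r * cexp 0 y)) <= M.
Proof.
move=> fd; pose u (y : R) := normc (f (a + r * cexp 0 y)) : R.
have uc : {within `[0, pi *+ 2], continuous u}.
  suff uc0 (y : R) : {for y, continuous u}.
    by apply: continuous_subspaceT => y; exact: uc0.
  pose h : K -> K := fun z => f (a + r * z).
  have /derivableP : derivable h (cexp 0 y) 1.
    apply/derivableC; apply: (@differentiable_comp _ _ _ _ (fun z : K => a + r * z) f).
      exact: differentiable_affine.
    apply/derivableC/fd.
    by rewrite addrAC subrr add0r normcM normc_cexp expR0 mulr1.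
  set c := 'D_1 h _ => fc.
  have [d d0 H] := polar_estimate fc ltr01.
  apply/cvgrPdist_le => e e0.
  pose C : R := 1 + normc c; have C0 : 0 < C by rewrite ltr_pwDl// normc_ge0.
  apply/nbhs_ballP; exists (Num.min d (e / C)) => [|t].
    by rewrite /= lt_min d0 divr_gt0.
  rewrite /ball /= lt_min distrC => /andP[td te].
  have := H 0 (t - y); rewrite normr0 addr0 subrKC add0r mul1r => /(_ d0 td) {}H.
  have tri (p q : K) : `|normc p - normc q| <= normc (q - p) :> R.
    rewrite ler_norml lerBlDr lerNl opprB lerBlDr; apply/andP; split.
      by rewrite -{1}(subrK p q) le_normcD.
    by rewrite normcB -{1}(subrK q p) le_normcD.
  apply: le_trans (tri _ _) _.
  rewrite /h in H; set A := f (a + _) - _ in H *.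
  rewrite -(subrK (c * cexp 0 y * (0 +i* (t - y))%C) A).
  apply: le_trans (le_normcD _ _) _; rewrite !normcM normc_cexp expR0 mulr1.
  have -> : normc (0 +i* (t - y))%C = `|t - y|.
    by rewrite /normc /= expr0n add0r sqrtr_sqr.
  apply: le_trans (lerD H (lexx _)) _.
  by rewrite -[X in X + _]mul1r -mulrDl mulrC -ler_pdivlMr// ltW.
have [|m _ H] := @EVT_max R u 0 (pi *+ 2) _ uc.
  by rewrite mulrn_wge0// pi_ge0.
by exists (u m) => y hy; apply: H; rewrite in_itv.
Qed.

End MeanValue.

(** * Identity principle and open mapping property *)

Section ComplexCalculus.
Variable R : realType.
Notation K := (Cplx R).
Implicit Types f g : K -> K.

Lemma derivableC_cst (c z : K) : derivable (fun _ : K => c) z 1.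
Proof. exact: derivable_cst. Qed.

Lemma derivableC_affine (p q z : K) : derivable (fun w : K => p + q * w) z 1.
Proof. by apply/derivableC; exact: differentiable_affine. Qed.

Lemma derivableC_comp f g (z : K) : derivable f z 1 -> derivable g (f z) 1 ->
  derivable (fun w => g (f w)) z 1.
Proof.
by move=> /derivableC df /derivableC dg; apply/derivableC; exact: (differentiable_comp df dg).
Qed.

Lemma derivableC_mul f g (z : K) : derivable f z 1 -> derivable g z 1 ->
  derivable (fun w => f w * g w) z 1.
Proof.
move=> /derivableC df /derivableC dg; apply/derivableC.
exact: (differentiableM df dg).
Qed.

Lemma derivableC_sub f g (z : K) : derivable f z 1 -> derivable g z 1 ->
  derivable (fun w => f w - g w) z 1.
Proof.
move=> /derivableC df /derivableC dg; apply/derivableC.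
exact: (differentiableB df dg).
Qed.

Lemma derivableC_inv f (z : K) : derivable f z 1 -> f z != 0 ->
  derivable (fun w => (f w)^-1) z 1.
Proof. by move=> /derivableC df fz; apply/derivableC; exact: (differentiableV df fz). Qed.

Lemma derivableC_exp f k (z : K) : derivable f z 1 ->
  derivable (fun w => f w ^+ k) z 1.
Proof.
move=> df; elim: k => [|k IH]; first exact: derivableC_cst.
have -> : (fun w => f w ^+ k.+1) = (fun w => f w * f w ^+ k).
  by apply/funext => w; rewrite exprS.
exact: derivableC_mul.
Qed.

Lemma derivableC_near f g (z : K) (d : R) : 0 < d ->
  (forall w : K, normc (w - z) < d -> f w = g w) ->
  derivable f z 1 -> derivable g z 1.
Proof.
move=> d0 fg; apply: near_eq_derivable.
by apply/nbhsC; exists d => // w /fg.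
Qed.

Lemma normcX (z : K) k : normc (z ^+ k) = normc z ^+ k.
Proof.
elim: k => [|k IH]; first by rewrite !expr0 normc1.
by rewrite !exprS normcM IH.
Qed.

(* The center maximum principle for [f / (z - p) ^ k] on a circle around [a]
   all of whose points are farther from [p] than [a] is; let [k] grow. *)
Lemma vanishing_quarter f (p a : K) (rho eta : R) : 0 < eta ->
  (forall z : K, normc (z - p) < rho -> derivable f z 1) ->
  (forall z : K, normc (z - p) < eta -> f z = 0) ->
  normc (a - p) < rho / 4 -> f a = 0.
Proof.
move=> eta0 fd f0 ap.
have [->|anep] := eqVneq a p; first by apply: f0; rewrite subrr normc0.
set d : R := normc (a - p) in ap *.
have d0 : 0 < d by rewrite normc_gt0 subr_eq0.
(* The disc of radius [tau] about [a] lies in the disc of radius [rho] about [p], and its boundary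
   stays at distance at least [tau - d > d] from [p]. The ratio [q] of these distances is thus less
   than 1. *)
pose tau : R := rho / 2.
have tau0 : 0 < tau by rewrite /tau; lra.
pose r : K := tau%:C%C.
have nr : normc r = tau :> R by rewrite normcC ger0_norm// ltW.
have inball (z : K) : normc (z - a) <= tau -> normc (z - p) < rho.
  move=> za; rewrite -(subrK a z) -addrA (le_lt_trans (le_normcD _ _))//.
  by rewrite -/d; move: za ap; rewrite /tau; lra.
have fd' (z : K) : normc (z - a) <= normc r -> derivable f z 1.
  by rewrite nr => /inball; exact: fd.
have [M HM] := circle_bounded fd'.
have p2 : (0 : R) <= 0 <= (pi : R) *+ 2.
  by apply/andP; split => //; rewrite mulrn_wge0 ?pi_ge0.
have M0 : 0 <= M by exact: le_trans (normc_ge0 _) (HM 0 p2).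
pose q : R := d / (tau - d).
have dtau : d < tau - d by rewrite /tau; lra.
have t0 : 0 < tau - d by exact: lt_trans dtau.
have q0 : 0 <= q by rewrite divr_ge0// ltW.
have q1 : q < 1 by rewrite /q ltr_pdivrMr ?mul1r.
have far (y : R) : tau - d <= normc (a + r * cexp 0 y - p).
  have := le_normcD (a + r * cexp 0 y - p) (p - a).
  rewrite addrA subrK [a + _]addrC addrK normcM nr normc_cexp expR0 mulr1.
  by rewrite [normc (p - a)]normcB -/d; lra.
have bnd k : normc (f a) <= M * q ^+ k.
  pose g (z : K) : K := f z * ((- p + 1 * z) ^+ k)^-1.
  have gE (z : K) : g z = f z / (z - p) ^+ k by rewrite /g mul1r [- p + _]addrC.
  have gd (z : K) : normc (z - a) <= normc r -> derivable g z 1.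
    move=> /[dup] /fd' fz; rewrite nr => /inball zrho.
    have [->|zp] := eqVneq z p.
      (* Near [p] the factor [f] vanishes, hence so does [g], even at [p] itself, where the
         denominator may be 0. *)
      apply: (@derivableC_near (cst 0) g p eta eta0); last exact: derivableC_cst.
      by move=> w wp; rewrite /g f0// mul0r.
    apply: derivableC_mul; first exact: fz.
    apply: derivableC_inv; first by apply: derivableC_exp; exact: derivableC_affine.
    by rewrite expf_neq0// mul1r addrC subr_eq0.
  have gM (y : R) : 0 <= y <= pi *+ 2 ->
      normc (g (a + r * cexp 0 y)) <= M * ((tau - d) ^+ k)^-1.
    move=> hy; rewrite gE normcM normcV normcX.
    apply: ler_pM; [exact: normc_ge0| |exact: HM|].
      by rewrite invr_ge0 exprn_ge0// normc_ge0.
    have tk : 0 < (tau - d) ^+ k by rewrite exprn_gt0.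
    have le := far y.
    have lek : (tau - d) ^+ k <= normc (a + r * cexp 0 y - p) ^+ k.
      by rewrite lerXn2r// ?nnegrE ?normc_ge0// ltW.
    by rewrite lef_pV2 ?posrE// (lt_le_trans tk).
  have := max_modulus_center gd gM.
  rewrite gE normcM normcV normcX -/d ler_pdivrMr ?exprn_gt0// /q expr_div_n.
  by rewrite mulrAC -mulrA.
apply/eqP; rewrite -normc_eq0 eq_le normc_ge0 andbT.
apply/ler_addgt0Pr => e e0; rewrite add0r.
have /(@cvgr0Pnorm_le R R) qc : q ^+ n @[n --> \oo] --> 0.
  by apply: cvg_expr; rewrite ger0_norm.
have [|n _ Hn] := qc (e / (M + 1)); first by rewrite divr_gt0// ltr_wpDl.
have := Hn n (leqnn n); rewrite /= ger0_norm ?exprn_ge0// => qe.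
apply: le_trans (bnd n) _; apply: le_trans (ler_wpM2l M0 qe) _.
by rewrite mulrCA ler_piMr ?ltW// ltr_pdivrMr ?ltr_wpDl// mul1r ltrDl.
Qed.

Lemma derive0_constant f (a z : K) :
  (forall t : R, 0 <= t <= 1 -> is_derive (a + t%:C%C * (z - a)) 1 f 0) ->
  f z = f a.
Proof.
move=> fd.
(* [L] stands for the real or the imaginary part; along the segment from [a] to [z] it yields a real
   function of one real variable with derivative 0. *)
suff H (L : K -> R) : (forall u v : K, L (u - v) = L u - L v) ->
    (forall w : K, `|L w| <= normc w) -> L (f z) = L (f a).
  apply/eqP; rewrite eq_complex; apply/andP; split; apply/eqP.
    apply: (H (@complex.Re R)); last exact: abs_re_le.
    by move=> u v; rewrite ReCD ReCN.
  apply: (H (@complex.Im R)); last exact: abs_im_le.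
  by move=> u v; rewrite ImCD ImCN.
move=> LB Lle; pose F (t : R) : R := L (f (a + t%:C%C * (z - a))).
have FE0 : F 0 = L (f a) by rewrite /F mul0r addr0.
have FE1 : F 1 = L (f z) by rewrite /F mul1r subrKC.
have Fd (t : R) : 0 <= t <= 1 -> is_derive t 1 F 0.
  move=> /fd/is_deriveCP H; apply/is_deriveP => e e0.
  pose C := normc (z - a) + 1; have C0 : 0 < C by rewrite ltr_wpDl// normc_ge0.
  have [|d d0 {}H] := H (e / C); first by rewrite divr_gt0.
  exists (d / C); first by rewrite divr_gt0.
  move=> h; rewrite ltr_pdivlMr// => hd.
  have nh : normc (h%:C%C * (z - a)) = `|h| * normc (z - a) by rewrite normcM normcC.
  have := H (h%:C%C * (z - a)); rewrite nh.
  have -> : `|h| * normc (z - a) < d.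
    by apply: le_lt_trans hd; rewrite ler_wpM2l// /C lerDl.
  move=> /(_ isT); rewrite !mul0r !subr0 => {}H.
  rewrite /F rmorphD/= mulrDl addrA -LB (le_trans (Lle _))// (le_trans H)//.
  rewrite mulrCA mulrC ler_wpM2r// mulrAC ler_pdivrMr// ler_wpM2l// ?ltW//.
  by rewrite /C ltrDl.
have := @primitive_unique R F (cst 0) (cst 0) 0 1 ler01 Fd (fun x _ => is_derive_cst _ _ _).
by rewrite FE0 FE1 /cst subrr => /eqP; rewrite subr_eq0 => /eqP.
Qed.

(** If [w] were not taken, the inverse of [f - w] would be holomorphic on a disc about [s0]. Since
    [c] is nonzero, [f - w] is bounded below on the boundary circle by [kappa], while at the center
    it is smaller: this contradicts the maximum principle. *)
Lemma open_mapping_at f (s0 c : K) (delta : R) : 0 < delta -> c != 0 ->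
  (forall z : K, normc (z - s0) < delta -> derivable f z 1) ->
  is_derive s0 1 f c ->
  exists2 kappa : R, 0 < kappa & forall w : K, normc (w - f s0) < kappa ->
    exists2 s : K, normc (s - s0) < delta & f s = w.
Proof.
move=> delta0 c0 fd /is_deriveCP H.
have nc0 : 0 < normc c by rewrite normc_gt0.
have [|d d0 {}H] := H (normc c / 2); first by rewrite divr_gt0.
pose tau := Num.min d delta / 2.
have tau0 : 0 < tau by rewrite divr_gt0// lt_min d0.
have [taud taudelta] : tau < d /\ tau < delta.
  by rewrite /tau; case: (lerP d delta) => h; split; lra.
clearbody tau.
pose r : K := tau%:C%C.
have nr : normc r = tau :> R by rewrite normcC ger0_norm// ltW.
(* On the circle of radius [tau], [f] is at distance at least [normc c * tau / 2 = 2 * kappa] from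
   [f s0], hence at least [kappa] from [w]. *)
pose kappa := normc c * tau / 4.
have kappa0 : 0 < kappa by rewrite !(mulr_gt0, divr_gt0).
exists kappa => // w wk; apply: contrapT => nex.
have fw (z : K) : normc (z - s0) <= tau -> f z - w != 0.
  move=> zt; rewrite subr_eq0; apply/eqP => fzw; apply: nex; exists z => //.
  exact: le_lt_trans zt _.
have gd (z : K) : normc (z - s0) <= normc r -> derivable (fun z => (f z - w)^-1) z 1.
  rewrite nr => zt; apply: derivableC_inv; last exact: fw.
  apply: derivableC_sub; last exact: derivableC_cst.
  by apply: fd; exact: le_lt_trans zt _.
have gM (y : R) : 0 <= y <= pi *+ 2 ->
    normc ((f (s0 + r * cexp 0 y) - w)^-1) <= kappa^-1.
  move=> _; set h := r * cexp 0 y.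
  have nh : normc h = tau by rewrite normcM nr normc_cexp expR0 mulr1.
  have {}H := H h; rewrite nh in H; have {}H := H taud.
  have ge : kappa <= normc (f (s0 + h) - w).
    have := le_normcD (f (s0 + h) - w) (w - f s0 - (f (s0 + h) - f s0 - c * h)).
    rewrite (_ : _ + _ = c * h); last by ring.
    have := le_normcD (w - f s0) (- (f (s0 + h) - f s0 - c * h)).
    rewrite normcN normcM nh.
    have -> : normc c * tau = 4 * kappa by rewrite /kappa; field.
    have E : normc c / 2 * tau = 2 * kappa by rewrite /kappa; field.
    by rewrite E in H; lra.
  by rewrite normcV lef_pV2 ?posrE// (lt_le_trans kappa0).
have := max_modulus_center gd gM; rewrite normcV lef_pV2 ?posrE//; last first.
  by rewrite normc_gt0 fw// subrr normc0 ltW.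
by rewrite normcB leNgt wk.
Qed.

End ComplexCalculus.

(** The real and imaginary parts of [W dz] are [P dx - Q dy] and [Q dx + P dy], both closed by the
    Cauchy-Riemann equations; their potentials are the two parts of the primitive. The square of
    half side [rho / 3] contains the smaller disc and lies inside the larger one. *)
Lemma holomorphic_primitive (R : realType) (W : Cplx R -> Cplx R) (p : Cplx R) (rho : R) :
  0 < rho -> (forall z : Cplx R, normc (z - p) < rho -> derivable W z 1) ->
  exists g : Cplx R -> Cplx R,
    forall z : Cplx R, normc (z - p) < rho / 3 -> is_derive z 1 g (W z).
Proof.
move=> rho0 Wd; case: p Wd => a b Wd.
pose P (x y : R) := complex.Re (W (x +i* y)%C).
pose Q (x y : R) := complex.Im (W (x +i* y)%C).
pose x0 := a - rho / 3; pose x1 := a + rho / 3.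
pose y0 := b - rho / 3; pose y1 := b + rho / 3.
have x01 : x0 <= x1 by rewrite /x0 /x1; lra.
have y01 : y0 <= y1 by rewrite /y0 /y1; lra.
have est (x y : R) : x0 <= x <= x1 -> y0 <= y <= y1 -> exists c : Cplx R,
    forall e : R, 0 < e -> exists2 d : R, 0 < d & forall x' y' : R,
    `|x' - x| < d -> `|y' - y| < d ->
    normc (W (x' +i* y')%C - W (x +i* y)%C - c * ((x' - x) +i* (y' - y))%C)
      <= e * (`|x' - x| + `|y' - y|).
  rewrite /x0 /x1 /y0 /y1 => hx hy.
  have : derivable W (x +i* y)%C 1.
    apply: Wd; apply: le_lt_trans (normc_le_re_im _) _ => /=.
    have : `|x - a| <= rho / 3 by rewrite ler_distl.
    have : `|y - b| <= rho / 3 by rewrite ler_distl.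
    by lra.
  move=> /derivableP; set c := 'D_1 W _ => /is_deriveCP H.
  exists c => e e0; have [d d0 {}H] := H e e0.
  exists (d / 2); first by lra.
  move=> x' y' xd yd; pose h : Cplx R := ((x' - x) +i* (y' - y))%C.
  have hS : normc h <= `|x' - x| + `|y' - y| by exact: normc_le_re_im.
  have := H h (ltac:(by apply: le_lt_trans hS _; lra)).
  have -> : (x +i* y)%C + h = (x' +i* y')%C.
    by apply/eqP; rewrite eq_complex /= !subrKC !eqxx.
  by move=> /le_trans; apply; rewrite ler_wpM2l// ltW.
have cf1 : closed_form_on (fun x y => - Q x y) P x0 x1 y0 y1.
  move=> x y hx hy; have [c H] := est x y hx hy.
  exists (complex.Re c), (- complex.Im c), (- complex.Re c) => e e0.
  have [d d0 {}H] := H e e0; exists d => // x' y' _ _ xd yd.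
  have {}H := H x' y' xd yd; split; apply: le_trans H.
    apply: le_trans (abs_re_le _); rewrite !(ReCD, ReCN) ReCM /=.
    by rewrite mulNr.
  apply: le_trans (abs_im_le _); rewrite !(ImCD, ImCN) ImCM /= -normrN.
  by rewrite le_eqVlt; apply/orP; left; apply/eqP; congr (`|_|); rewrite /Q; ring.
have cf2 : closed_form_on P Q x0 x1 y0 y1.
  move=> x y hx hy; have [c H] := est x y hx hy.
  exists (complex.Im c), (complex.Re c), (- complex.Im c) => e e0.
  have [d d0 {}H] := H e e0; exists d => // x' y' _ _ xd yd.
  have {}H := H x' y' xd yd; split; apply: le_trans H.
    apply: le_trans (abs_im_le _); rewrite !(ImCD, ImCN) ImCM /=.
    by rewrite [complex.Re c * _ + _]addrC.
  apply: le_trans (abs_re_le _); rewrite !(ReCD, ReCN) ReCM /=.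
  by rewrite mulNr.
have [G1 H1] := closed_form_potential x01 y01 cf1.
have [G2 H2] := closed_form_potential x01 y01 cf2.
exists (fun z => (G1 (complex.Re z) (complex.Im z) +i* G2 (complex.Re z) (complex.Im z))%C).
case=> x y xy; apply/is_deriveCP => e e0.
have xa : `|x - a| < rho / 3 by exact: le_lt_trans (abs_re_le (_ - _)) xy.
have yb : `|y - b| < rho / 3 by exact: le_lt_trans (abs_im_le (_ - _)) xy.
have inx (s : R) : `|s| < rho / 3 - `|x - a| -> x0 <= x + s <= x1.
  move=> hs; rewrite -ler_distl addrAC (le_trans (ler_normD _ _))//; lra.
have iny (s : R) : `|s| < rho / 3 - `|y - b| -> y0 <= y + s <= y1.
  move=> hs; rewrite -ler_distl addrAC (le_trans (ler_normD _ _))//; lra.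
have hx : x0 <= x <= x1 by rewrite -[x]addr0 inx// normr0 subr_gt0.
have hy : y0 <= y <= y1 by rewrite -[y]addr0 iny// normr0 subr_gt0.
have e4 : 0 < e / 4 by lra.
have [d1 d10 {}H1] := H1 x y hx hy _ e4.
have [d2 d20 {}H2] := H2 x y hx hy _ e4.
exists (Num.min (Num.min d1 d2) (Num.min (rho / 3 - `|x - a|) (rho / 3 - `|y - b|))).
  by rewrite !lt_min d10 d20 !subr_gt0 xa yb.
case=> s t; set h : Cplx R := (s +i* t)%C; rewrite !lt_min.
move=> /andP[/andP[hd1 hd2] /andP[hxa hyb]].
have sh : `|s| <= normc h by exact: (abs_re_le h).
have th : `|t| <= normc h by exact: (abs_im_le h).
have hx' := inx _ (le_lt_trans sh hxa); have hy' := iny _ (le_lt_trans th hyb).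
have ex : x + s - x = s by rewrite addrAC subrr add0r.
have ey : y + t - y = t by rewrite addrAC subrr add0r.
have := H1 _ _ hx' hy'; rewrite ex ey.
move=> /(_ (le_lt_trans sh hd1) (le_lt_trans th hd1)) {}H1.
have := H2 _ _ hx' hy'; rewrite ex ey.
move=> /(_ (le_lt_trans sh hd2) (le_lt_trans th hd2)) {}H2.
apply: le_trans (normc_le_re_im _) _; move: (normc h) sh th hd1 hd2 hxa hyb => N sh th hd1 hd2 hxa hyb.
rewrite !(ReCD, ReCN, ImCD, ImCN) ReCM ImCM /=.
rewrite -/(P x y) -/(Q x y) -mulNr [P x y * t + _]addrC.
have : e / 4 * (`|s| + `|t|) <= e / 4 * (N + N) by rewrite ler_wpM2l ?lerD// ltW.
have -> : e / 4 * (N + N) = e * N / 2 by field.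
have : 0 <= e * N by rewrite mulr_ge0 ?(le_trans _ sh)// ltW.
move: H1 H2; set A := e / 4 * _; set B := e * N.
by clear; lra.
Qed.

(** * Holomorphic functions on compact manifolds *)

Lemma near_eq_differentiable (K : numFieldType) (V W : normedModType K)
    (f g : V -> W) (x : V) :
  (\forall y \near x, f y = g y) -> differentiable f x -> differentiable g x.
Proof.
move=> fg /diff_locallyP[cf /eqaddoP fo].
have go : g \o shift x = cst (g x) + 'd f x +o_ 0 id.
  apply/eqaddoP => e e0; have := fo e e0.
  have : \forall h \near (0 : V), f (h + x) = g (h + x).
    have : \forall h \near (0 : V), (fun y => f y = g y) (h + x).
      by have := near_shift 0 x (fun y => f y = g y); rewrite subr0 => <-.
    by [].
  apply: filterS2 => h fgh; rewrite !fctE /= => H.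
  by rewrite -fgh -(nbhs_singleton fg).
by apply/diff_locallyP; rewrite (diff_unique cf go).
Qed.

Section ChartFacts.
Variable R : realType.
Notation K := (Cplx R).

Lemma nbhs_rVC n (v : 'rV[K]_n) (A : set 'rV[K]_n) : nbhs v A <->
  exists2 d : R, 0 < d & forall w : 'rV[K]_n,
    (forall j, normc (w 0 j - v 0 j) < d) -> A w.
Proof.
split=> [/nbhs_ballP[e /= e0 H]|[d d0 H]].
  have eE : e = (complex.Re e)%:C%C by rewrite RRe_real// gtr0_real.
  exists (complex.Re e); first by rewrite -ltcR -eE.
  move=> w wv; apply: H; split=> // i j; rewrite (ord1 i) -ball_normE /= distrC.
  by rewrite normrC eE ltcR.
apply/nbhs_ballP; exists d%:C%C; first by rewrite /= ltcR.
move=> w [_ wv]; apply: H => j; have := wv 0 j.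
by rewrite -ball_normE /= distrC normrC ltcR.
Qed.

Lemma differentiable_line n (p u : 'rV[K]_n) (z : K) :
  differentiable (fun t : K => p + t *: u) z.
Proof.
have -> : (fun t : K => p + t *: u) = cst p + ( *:%R ^~ u) by [].
by apply: differentiableD; [exact: differentiable_cst|exact: ex_diff].
Qed.

Lemma differentiable_entry m n (V : normedModType K) (f : V -> 'M[K]_(m, n)) x i j :
  differentiable f x -> differentiable (fun v => f v i j : K) x.
Proof.
by move=> df; exact: (differentiable_comp df (differentiable_coord (f x) i j)).
Qed.

Lemma derivable_differentiable_comp (V : normedModType K) (f : V -> K) (g : K -> K) x :
  differentiable f x -> derivable g (f x) 1 -> differentiable (fun v => g (f v)) x.
Proof. by move=> df /derivableC dg; exact: (differentiable_comp df dg). Qed.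

Lemma derivable_line n (f : 'rV[K]_n -> K) (p u : 'rV[K]_n) (t : K) :
  differentiable f (p + t *: u) -> derivable (fun s : K => f (p + s *: u)) t 1.
Proof.
move=> df; apply/derivableC.
exact: (differentiable_comp (differentiable_line p u t) df).
Qed.

Section Chart.
Variables (T : topologicalType) (n : nat) (c : chart R T n).

Lemma nbhs_cdom x : cdom c x -> nbhs x (cdom c).
Proof. by move=> cx; apply: open_nbhs_nbhs; split=> //; exact: cdom_open. Qed.

Lemma cfun_continuous x : cdom c x -> {for x, continuous (cfun c)}.
Proof.
move=> cx; have := @cfun_cont _ _ _ c.
by rewrite continuous_open_subspace; [apply; exact: mem_set|exact: cdom_open].
Qed.

Lemma cinv_continuous x : cdom c x -> {for cfun c x, continuous (cinv c)}.
Proof.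
move=> cx; have := @cinv_cont _ _ _ c.
rewrite continuous_open_subspace; last exact: cimg_open.
by apply; apply: mem_set; exists x.
Qed.

Lemma cinvK x : cdom c x -> cinv c (cfun c x) = x.
Proof. by move=> cx; rewrite cfunK// mem_set. Qed.

Lemma cfun_inj x y : cdom c x -> cdom c y -> cfun c x = cfun c y -> x = y.
Proof. by move=> cx cy e; rewrite -(cinvK cx) e cinvK. Qed.

(** The image of a chart is open, so it contains a polydisc, on which [cinv] is a true inverse. *)
Lemma chart_ball x : cdom c x -> exists2 rho : R, 0 < rho &
  forall v : 'rV[K]_n, (forall j, normc (v 0 j - cfun c x 0 j) < rho) ->
    cdom c (cinv c v) /\ cfun c (cinv c v) = v.
Proof.
move=> cx; have : nbhs (cfun c x) (cfun c @` cdom c).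
  by apply: open_nbhs_nbhs; split; [exact: cimg_open|exists x].
move=> /nbhs_rVC[rho rho0 H]; exists rho => // v /H[y cy <-].
by rewrite cinvK.
Qed.

Lemma near_chart x (A : set T) (rho : R) : cdom c x -> 0 < rho ->
  (forall y, cdom c y ->
    (forall j, normc (cfun c y 0 j - cfun c x 0 j) < rho) -> A y) ->
  nbhs x A.
Proof.
move=> cx rho0 H.
have cc : nbhs x (cfun c @^-1` [set v : 'rV[K]_n |
    forall j, normc (v 0 j - cfun c x 0 j) < rho]).
  by apply: (cfun_continuous cx); apply/nbhs_rVC; exists rho.
by apply: filterS2 (nbhs_cdom cx) cc => y cy /H; exact.
Qed.

End Chart.

(** Local constancy of [Q] makes both the set where it holds and its complement open. *)
Lemma connected_locally_constant (T : topologicalType) (Q : T -> Prop) :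
  connected [set: T] -> (forall x, \forall y \near x, Q y <-> Q x) ->
  forall x y, Q x -> Q y.
Proof.
move=> cT HQ x y Qx.
have oQ : open [set z | Q z].
  rewrite openE => z /= Qz; have := HQ z; apply: filterS => w.
  by move=> [_]; exact.
have oN : open [set z | ~ Q z].
  rewrite openE => z /= nQz; have := HQ z; apply: filterS => w.
  by move=> [h _] /h.
have : [set z | Q z] = [set: T].
  apply: (cT [set z | Q z]); first by exists x.
    by exists [set z | Q z] => //; rewrite setTI.
  exists [set z | Q z]; last by rewrite setTI.
  have -> : [set z | Q z] = ~` [set z | ~ Q z].
    by apply/seteqP; split=> z /=; [move=> h; exact|exact: contrapT].
  exact: open_closedC.
by move=> /seteqP[_ /(_ y)]; exact.
Qed.

Section HolomorphicFunctions.
Variables (m : nat) (M : complexManifold R m).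

Definition holomorphic_function (f : M -> K) : Prop :=
  forall c, atlas c -> forall x, cdom c x ->
    differentiable (fun v => f (cinv c v)) (cfun c x).

Lemma holomorphic_function_continuous f : holomorphic_function f -> continuous f.
Proof.
move=> hf x; have [c ac cx] := atlas_cover x.
have /differentiable_continuous fc := hf c ac x cx.
move=> A fA; rewrite -(cinvK cx) in fA.
have /(cfun_continuous cx) := fc A fA.
rewrite /= !nbhs_simpl => fcA; apply: filterS2 (nbhs_cdom cx) fcA => y cy /=.
by rewrite cinvK.
Qed.

(** The maximum principle is applied on the complex line that joins [x] to a nearby [y] in a chart,
    over the closed unit disc of the parameter. *)
Lemma holomorphic_function_local_max f x : holomorphic_function f ->
  (forall y, normc (f y) <= normc (f x)) -> \forall y \near x, f y = f x.
Proof.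
move=> hf fx; have [c ac cx] := atlas_cover x.
have [rho rho0 H] := chart_ball cx.
apply: (@near_chart _ _ c x (fun y => f y = f x) rho cx rho0) => y cy yx.
pose u := cfun c y - cfun c x.
pose phi (t : K) := f (cinv c (cfun c x + t *: u)).
have phid (t : K) : normc (t - 0) <= normc (-1 : K) -> derivable phi t 1.
  rewrite subr0 normcN normc1 => t1.
  have [|h1 h2] := H (cfun c x + t *: u).
    move=> j; rewrite !mxE addrAC subrr add0r normcM.
    by apply: le_lt_trans (yx j); rewrite ler_piMl ?normc_ge0// !mxE.
  apply: (@derivable_line _ (fun v => f (cinv c v))).
  by rewrite -h2; exact: (hf c ac _ h1).
(* With radius -1 the conclusion concerns the parameter [0 - (-1) = 1], at which the line reaches
   [y]. *)
have := @max_modulus_circle R phi 0 (-1) phid.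
have phi0 : phi 0 = f x by rewrite /phi scale0r addr0 cinvK.
rewrite phi0 sub0r opprK => /(_ (fun y _ => fx _)).
by rewrite /phi scale1r /u subrKC cinvK.
Qed.

(** By compactness the modulus has a maximum, at [xm]. The set where [f] equals [f xm] is open by
    the local maximum principle and closed by continuity. *)
Lemma holomorphic_function_constant f : compact_connected M ->
  holomorphic_function f -> forall x y, f x = f y.
Proof.
move=> [cM coM] hf.
have fc := holomorphic_function_continuous hf.
have {}fc x A : nbhs (f x) A -> nbhs x (f @^-1` A) by exact: fc.
move=> x1 x2; pose u (x : M) : R := normc (f x).
have uc : {within [set: M], continuous u}.
  apply: continuous_subspaceT => x.
  suff : u @ x --> u x by [].
  apply/(@cvgrPdist_lt R R) => e e0.
  have : nbhs (f x) [set w : K | normc (w - f x) < e] by apply/nbhsC; exists e.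
  move=> /fc; apply: filterS => y /=.
  apply: le_lt_trans; rewrite /u ler_norml lerBlDr lerNl opprB lerBlDr.
  apply/andP; split.
    by have := le_normcD (f y - f x) (f x); rewrite subrK.
  by have := le_normcD (f x - f y) (f y); rewrite subrK [normc (f x - _)]normcB.
have [||xm _ Hm] := @compact_EVT_max M R u [set: M] _ _ uc.
- by exists x1.
- exact: cM.
have {}Hm y : normc (f y) <= normc (f xm) by apply: Hm; rewrite inE.
suff H x : f x = f xm by rewrite !H.
apply: (@connected_locally_constant M (fun x => f x = f xm) coM _ xm x erefl).
move=> y; have [fy|fy] := pselect (f y = f xm).
  have := @holomorphic_function_local_max f y hf.
  by rewrite fy => /(_ Hm); apply: filterS => z ->.
have d0 : 0 < normc (f xm - f y).
  by rewrite normc_gt0 subr_eq0; apply/eqP => h; apply: fy.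
have : nbhs (f y) [set w : K | normc (w - f y) < normc (f xm - f y)].
  by apply/nbhsC; exists (normc (f xm - f y)).
move=> /fc; apply: filterS => z /= zy; split=> // h.
by move: zy; rewrite h ltxx.
Qed.

End HolomorphicFunctions.
End ChartFacts.

(** * One-forms on a Riemann surface *)

Lemma is_deriveC_comp (R : realType) (f g : Cplx R -> Cplx R) (z c d : Cplx R) :
  is_derive z 1 f c -> is_derive (f z) 1 g d ->
  is_derive z 1 (fun w => g (f w)) (d * c).
Proof.
move=> /is_deriveCP Hf /is_deriveCP Hg; apply/is_deriveCP => e e0.
pose C := normc c + 1; have C0 : 0 < C by rewrite ltr_wpDl// normc_ge0.
pose E := normc d + 1; have E0 : 0 < E by rewrite ltr_wpDl// normc_ge0.
have [|d1 d10 {}Hg] := Hg (e / 2 / C); first by rewrite !divr_gt0.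
have [d2 d20 Hf1] := Hf 1 ltr01.
have [|d3 d30 {}Hf] := Hf (e / 2 / E); first by rewrite !divr_gt0.
exists (Num.min (d1 / C) (Num.min d2 d3)); first by rewrite !lt_min d20 d30 divr_gt0.
move=> h; rewrite !lt_min ltr_pdivlMr// => /and3P[h1 h2 h3].
have {}Hf := Hf h h3; have := Hf1 h h2; rewrite mul1r => {}Hf1.
set eta := f (z + h) - f z in Hf Hf1.
have neta : normc eta <= C * normc h.
  rewrite -(subrK (c * h) eta); apply: le_trans (le_normcD _ _) _.
  by rewrite normcM /C mulrDl mul1r addrC lerD2l.
have fE : f (z + h) = f z + eta by rewrite /eta subrKC.
have eta1 : normc eta < d1 by apply: le_lt_trans neta _; rewrite mulrC.
have := Hg eta eta1; rewrite -fE => {}Hg.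
rewrite (_ : _ - d * c * h = (g (f (z + h)) - g (f z) - d * eta) +
  d * (eta - c * h)); last by ring.
apply: le_trans (le_normcD _ _) _; rewrite normcM.
have -> : e * normc h = e / 2 / C * (C * normc h) + E * (e / 2 / E * normc h).
  by field; rewrite !gt_eqF.
apply: lerD.
  by apply: le_trans Hg _; rewrite ler_wpM2l// !divr_ge0// ltW.
by apply: ler_pM => //; rewrite ?normc_ge0// /E lerDl.
Qed.

Section RiemannSurface.
Variables (R : realType) (X : complexManifold R 1).
Notation K := (Cplx R).
Implicit Types (c d : chart R X 1) (w : one_form_coef X).

Definition coord c (x : X) : K := cfun c x 0 0.
Definition coord_inv c (z : K) : X := cinv c (const_mx z).

Lemma const_mx_coord c x : const_mx (coord c x) = cfun c x.
Proof. by apply/rowP => j; rewrite mxE (ord1 j). Qed.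

Lemma coord_invK c x : cdom c x -> coord_inv c (coord c x) = x.
Proof. by move=> cx; rewrite /coord_inv const_mx_coord cinvK. Qed.

Lemma coord_ball c x : cdom c x -> exists2 rho : R, 0 < rho &
  forall z : K, normc (z - coord c x) < rho ->
    cdom c (coord_inv c z) /\ coord c (coord_inv c z) = z.
Proof.
move=> cx; have [rho rho0 H] := chart_ball cx; exists rho => // z zx.
have [|h1 h2] := H (const_mx z); first by move=> j; rewrite mxE (ord1 j).
by split=> //; rewrite /coord h2 mxE.
Qed.

Lemma near_coord c x (A : set X) (rho : R) : cdom c x -> 0 < rho ->
  (forall y, cdom c y -> normc (coord c y - coord c x) < rho -> A y) -> nbhs x A.
Proof. by move=> cx rho0 H; apply: (near_chart cx rho0) => y cy /(_ 0); exact: H. Qed.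

Lemma nbhs_coord c x (r : R) : cdom c x -> 0 < r ->
  nbhs x [set y | cdom c y /\ normc (coord c y - coord c x) < r].
Proof. by move=> cx r0; apply: (near_coord cx r0) => y cy yx; split. Qed.

Lemma nbhs_coord_inv c x (A : set X) : cdom c x -> nbhs x A ->
  exists2 r : R, 0 < r & forall z : K, normc (z - coord c x) < r -> A (coord_inv c z).
Proof.
move=> cx xA; have : nbhs (cfun c x) (cinv c @^-1` A).
  by apply: (cinv_continuous cx); rewrite cinvK.
move=> /nbhs_rVC[r r0 H]; exists r => // z zx; apply: H => j.
by rewrite mxE (ord1 j).
Qed.

Lemma differentiable_const_mx (z : K) :
  differentiable (const_mx : K -> 'rV[K]_1) z.
Proof.
have -> : (const_mx : K -> 'rV[K]_1) = (fun t => 0 + t *: const_mx 1).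
  by apply/funext => t; apply/rowP => j; rewrite !mxE add0r mulr1.
exact: differentiable_line.
Qed.

Lemma one_form_derivable w c x : holomorphic_one_form w -> atlas c -> cdom c x ->
  derivable (fun z => w c (coord_inv c z) 0 0) (coord c x) 1.
Proof.
move=> [_ hw] ac cx; apply/derivableC.
apply: (differentiable_entry 0 0).
apply: (differentiable_comp (differentiable_const_mx (coord c x))
  (g := w c \o cinv c)).
by rewrite const_mx_coord; exact: hw.
Qed.

(** In dimension one the Jacobian matrix has a single entry, the derivative of the coordinate
    change, and the covector rule becomes a product of scalars. *)
Lemma one_form_transition w c d x : holomorphic_one_form w ->
  atlas c -> atlas d -> cdom c x -> cdom d x ->
  exists J : K, is_derive (coord c x) 1 (fun z => coord d (coord_inv c z)) J /\
    w c x 0 0 = J * w d x 0 0.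
Proof.
move=> [hw _] ac ad cx dx.
have dt : differentiable (transition c d) (cfun c x) by exact: atlas_compatible.
have fd : derivable (transition c d) (cfun c x) (const_mx 1).
  exact: diff_derivable.
exists ('J (transition c d) (cfun c x) 0 0); split; last first.
  by rewrite (hw c d)// [LHS]mxE big_ord1.
have := deriveEjacobian (const_mx 1 : 'rV[K]_1) dt => DE.
have -> : 'J (transition c d) (cfun c x) 0 0 =
    ('D_(const_mx 1) (transition c d) (cfun c x)) 0 0.
  by rewrite DE [RHS]mxE big_ord1 [const_mx _ _ _]mxE mul1r.
pose q (h : K) := h^-1 *: ((transition c d \o shift (cfun c x)) (h *: const_mx 1) -
  transition c d (cfun c x)).
have qD : q h @[h --> 0^'] --> 'D_(const_mx 1) (transition c d) (cfun c x) by exact: fd.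
have qE h : q h 0 0 = h^-1 *: (coord d (coord_inv c (h *: 1 + coord c x)) -
    coord d (coord_inv c (coord c x))).
  rewrite /q !mxE /= /coord /coord_inv /transition /= const_mx_coord.
  congr (_ * (cfun d (cinv c _) 0 0 - _)).
  by apply/rowP => j; rewrite !mxE (ord1 j).
have tD : (fun h => h^-1 *: (coord d (coord_inv c (h *: 1 + coord c x)) -
    coord d (coord_inv c (coord c x)))) @ 0^' -->
   'D_(const_mx 1) (transition c d) (cfun c x) 0 0.
  under eq_fun do rewrite -qE.
  apply: (@cvg_comp _ _ _ q (fun M : 'rV[K]_1 => M 0 0) _ _ _ qD).
  exact: coord_continuous.
apply: DeriveDef; last exact: cvg_lim.
by apply/cvg_ex; eexists; exact: tD.
Qed.

(* The value of the 1-form [w] on the velocity vector at [t] of the curve [g],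
   computed in the chart [c]. *)
Definition pairing w c (g : K -> X) (t : K) : K :=
  w c (g t) 0 0 * 'D_1 (fun s => coord c (g s) : K) t.

(** The derivative [J] of the coordinate change from [c] to [d] multiplies the coefficient in [d] to
    give that in [c], and by the chain rule it multiplies the velocity in [c] to give that in
    [d]. *)
Lemma pairing_chart w c d (g : K -> X) (t : K) : holomorphic_one_form w ->
  atlas c -> atlas d -> cdom c (g t) -> cdom d (g t) -> {for t, continuous g} ->
  derivable (fun s => coord c (g s) : K) t 1 ->
  pairing w c g t = pairing w d g t.
Proof.
move=> hw ac ad cg dg gc gd.
have [J [HJ wE]] := one_form_transition hw ac ad cg dg.
have gdom : \forall s \near t, cdom c (g s) by apply: gc; exact: nbhs_cdom.
pose tau (z : K) : K := coord d (coord_inv c z).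
have := derivableP gd; set D := 'D_1 (fun s => coord c (g s) : K) t => HD.
suff H : is_derive t 1 (fun s => coord d (g s) : K) (J * D).
  by rewrite /pairing wE -/D (@derive_val _ _ _ _ _ _ _ H); ring.
have near_tau : \forall s \near t, tau (coord c (g s)) = coord d (g s).
  by apply: filterS gdom => s cs; rewrite /tau coord_invK.
apply: (near_eq_is_derive near_tau).
exact: is_deriveC_comp HD HJ.
Qed.

Lemma one_form_primitive w c x : holomorphic_one_form w -> atlas c -> cdom c x ->
  exists (g : K -> K) (rho : R), 0 < rho /\ forall y, cdom c y ->
    normc (coord c y - coord c x) < rho -> is_derive (coord c y) 1 g (w c y 0 0).
Proof.
move=> hw ac cx; have [rho rho0 H] := coord_ball cx.
have [|g Hg] := @holomorphic_primitive R (fun z => w c (coord_inv c z) 0 0)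
    (coord c x) rho rho0.
  by move=> z /H[h1 h2]; rewrite -h2; exact: one_form_derivable.
exists g, (rho / 3); split; first by rewrite divr_gt0.
by move=> y cy /Hg; rewrite coord_invK.
Qed.

Lemma one_form_eq0_chart w c d x : holomorphic_one_form w -> atlas c -> atlas d ->
  cdom c x -> cdom d x -> w d x 0 0 = 0 -> w c x 0 0 = 0.
Proof.
move=> hw ac ad cx dx wd; have [J [_ ->]] := one_form_transition hw ac ad cx dx.
by rewrite wd mulr0.
Qed.

(** The set of points near which [w] vanishes is open. It is also closed: in a chart disc about [x],
    vanishing near a point [y] close to [x] spreads, by [vanishing_quarter], to a neighborhood of
    [x]. *)
Lemma one_form_unique_continuation w (x0 : X) : connected [set: X] ->
  holomorphic_one_form w ->
  (\forall y \near x0, forall c, atlas c -> cdom c y -> w c y 0 0 = 0) ->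
  one_form_eq w (fun _ _ => 0).
Proof.
move=> coX hw w0.
pose V (x : X) := forall c, atlas c -> cdom c x -> w c x 0 0 = 0.
suff H (x : X) : \forall y \near x, V y.
  move=> c ac x cx; have /(_ c ac cx) := nbhs_singleton (H x).
  by move=> wx; apply/colP => i; rewrite (ord1 i) wx mxE.
apply: (@connected_locally_constant X (fun x : X => \forall y \near x, V y) coX _ x0 x w0).
move=> {}x; have [c ac cx] := atlas_cover x.
have [rho rho0 Hrho] := coord_ball cx.
(* For [y] within [rho / 8] of [x], the disc of radius [7 / 8 * rho] about [y] stays in the chart
   disc. A quarter of that radius exceeds [rho / 8 + rho / 16], so it covers the disc of radius
   [rho / 16] about [x]. *)
have rho8 : 0 < rho / 8 by rewrite divr_gt0.
have Vx_near : (\forall y \near x, V y) -> \forall z \near x, \forall y \near z, V y.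
  by move=> /nbhs_interior; apply.
have V_near : (exists2 r : R, 0 < r & forall z : K, normc (z - coord c x) < r ->
    w c (coord_inv c z) 0 0 = 0) -> \forall y \near x, V y.
  move=> [r r0 H]; apply: (near_coord cx r0) => y cy /H.
  by rewrite coord_invK// => wy e ae ey; apply: (one_form_eq0_chart hw ae ac ey cy).
have [wx|wx] := pselect (\forall y \near x, V y).
  by apply: filterS (Vx_near wx) => y Vy; split.
apply: (near_coord cx rho8) => y cy yx; split=> // Vy; exfalso; apply: wx.
apply: V_near; exists (rho / 16); first by rewrite divr_gt0.
move=> z zx.
have [r r0 Hr] := nbhs_coord_inv cy Vy.
pose r' := Num.min r (rho / 4).
have r'0 : 0 < r' by rewrite lt_min r0 divr_gt0.
apply: (@vanishing_quarter R (fun z => w c (coord_inv c z) 0 0) (coord c y) z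
  (7 / 8 * rho) r' r'0).
- move=> t ty; have [|t1 t2] := Hrho t.
    rewrite -(subrK (coord c y) t) -addrA (le_lt_trans (le_normcD _ _))//.
    by move: ty yx; lra.
  by rewrite -t2; exact: one_form_derivable.
- move=> t; rewrite lt_min => /andP[/Hr Vt tr]; apply: Vt => //.
  have [] := Hrho t => //.
  rewrite -(subrK (coord c y) t) -addrA (le_lt_trans (le_normcD _ _))//.
  by move: tr yx; lra.
- rewrite -(subrK (coord c x) z) -addrA (le_lt_trans (le_normcD _ _))//.
  by rewrite [normc (coord c x - _)]normcB; move: zx yx; lra.
Qed.

(* If the pairing vanished identically, the curve, being non-constant on every
   disc by the identity principle, would lie in the zeros of [w]; its image is
   open at [g s0], so [w] would vanish. *)
Lemma pairing_neq0 w c (g : K -> X) (s0 : K) (delta : R) : connected [set: X] ->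
  holomorphic_one_form w -> ~ one_form_eq w (fun _ _ => 0) -> 0 < delta ->
  (forall s : K, normc (s - s0) < delta -> {for s, continuous g} /\
    forall d, atlas d -> cdom d (g s) -> derivable (fun t => coord d (g t) : K) s 1) ->
  atlas c -> cdom c (g s0) -> 'D_1 (fun t => coord c (g t) : K) s0 != 0 ->
  exists s : K, normc (s - s0) < delta /\
    exists2 d, atlas d & cdom d (g s) /\ pairing w d g s != 0.
Proof.
move=> coX hw wn0 delta0 Hg ac cg g'0; apply: contrapT => Hno; apply: wn0.
pose phi (t : K) : K := coord c (g t); pose W (z : K) : K := w c (coord_inv c z) 0 0.
have ss0 : normc (s0 - s0) < delta by rewrite subrr normc0.
have [r r0 Hr] : exists2 r : R, 0 < r & forall s : K, normc (s - s0) < r ->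
    cdom c (g s).
  by apply/nbhsC; apply: (Hg s0 ss0).1; exact: nbhs_cdom.
pose rho := Num.min r delta; have rho0 : 0 < rho by rewrite lt_min r0.
have inrho (s : K) : normc (s - s0) < rho ->
    [/\ cdom c (g s), derivable phi s 1 & W (phi s) * 'D_1 phi s = 0].
  rewrite lt_min => /andP[/Hr cs sd]; have [_ /(_ c ac cs) gd] := Hg s sd.
  split=> //; apply/eqP; apply: contrapT => /negP ne; apply: Hno.
  exists s; split=> //; exists c => //; split=> //.
  by move: ne; rewrite /W /phi coord_invK.
(* If [W] is nonzero at [phi s1], the derivative of [phi] vanishes near [s1], so [phi] is constant
   there and, by the identity principle, also near [s0], against the nonzero derivative at [s0]. *)
have Wphi (s1 : K) : normc (s1 - s0) < rho / 8 -> W (phi s1) = 0.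
  move=> s1s; apply/eqP; apply: contrapT => /negP Wn0.
  have s1rho : normc (s1 - s0) < rho by move: s1s; lra.
  have [cs1 phid1 _] := inrho s1 s1rho.
  have Wd : derivable W (phi s1) 1 by exact: one_form_derivable.
  have /derivableP := derivableC_comp phid1 Wd.
  set D := 'D_1 (fun s => W (phi s)) s1 => /is_deriveCP HD.
  have [d d0 {}HD] := HD 1 ltr01.
  (* Near [s1] the increment of [W] along [phi] is at most [normc D + 1] times the distance; within
     [eta] this is less than half of [normc (W (phi s1))]. *)
  pose eta := Num.min (Num.min d (rho / 2)) (normc (W (phi s1)) / (2 * (normc D + 1))).
  have D1 : 0 < normc D + 1 by rewrite ltr_wpDl// normc_ge0.
  have eta0 : 0 < eta by rewrite !lt_min d0 !divr_gt0 ?mulr_gt0// normc_gt0.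
  have Wne (s : K) : normc (s - s1) < eta -> W (phi s) != 0.
    rewrite !lt_min => /andP[/andP[sd _] sW].
    have := HD (s - s1) sd; rewrite subrKC mul1r => H.
    apply/eqP => W0; rewrite W0 sub0r in H.
    have := le_normcD (- W (phi s1) - D * (s - s1)) (D * (s - s1)).
    rewrite subrK normcN normcM.
    move: sW; rewrite ltr_pdivlMr ?mulr_gt0// => sW k.
    have : 0 < normc (W (phi s1)) by rewrite normc_gt0.
    by move: sW k H; set A := normc (s - s1); set B := normc D; nra.
  have etarho : eta <= rho / 2 by rewrite !ge_min lexx orbT.
  have phi_const (s : K) : normc (s - s1) < eta -> phi s = phi s1.
    move=> ss1; apply: derive0_constant => t /andP[t0 t1].
    set u := s1 + _.
    have us1 : normc (u - s1) < eta.
      rewrite /u addrAC subrr add0r normcM normcC ger0_norm//.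
      by apply: le_lt_trans ss1; rewrite ler_piMl// normc_ge0.
    have [|_ phiu] := inrho u.
      rewrite -(subrK s1 u) -addrA (le_lt_trans (le_normcD _ _))//.
      by move: us1 s1s etarho rho0; lra.
    move=> /eqP; rewrite mulf_eq0 (negPf (Wne u us1)) /= => /eqP <-.
    exact/derivableP.
  have phi_s0 (s : K) : normc (s - s0) < rho / 16 -> phi s - phi s1 = 0.
    move=> ss; apply: (@vanishing_quarter R (fun s => phi s - phi s1) s1 s
      (7 / 8 * rho) eta eta0).
    - move=> t ts1; apply: derivableC_sub; last exact: derivableC_cst.
      have [] // := inrho t.
      rewrite -(subrK s1 t) -addrA (le_lt_trans (le_normcD _ _))//.
      by move: ts1 s1s; lra.
    - by move=> t /phi_const ->; rewrite subrr.
    - rewrite -(subrK s0 s) -addrA (le_lt_trans (le_normcD _ _))//.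
      by rewrite [normc (s0 - s1)]normcB; move: ss s1s; lra.
  have rho16 : 0 < rho / 16 by rewrite divr_gt0.
  have : is_derive s0 1 phi 0.
    have E1 : \forall s \near s0, phi s1 = phi s.
      apply/nbhsC; exists (rho / 16) => // s /phi_s0 /eqP.
      by rewrite subr_eq0 => /eqP ->.
    exact: (near_eq_is_derive E1 (is_derive_cst _ _ _)).
  by move=> [_ E]; move: g'0; rewrite [X in X != 0]E eqxx.
have rho8 : 0 < rho / 8 by rewrite divr_gt0.
have [||kappa kappa0 Hk] := @open_mapping_at R phi s0 _ _ rho8 g'0.
- by move=> z zs; have [] // := inrho z; move: zs rho0; lra.
- by apply/derivableP; have [] := inrho s0; rewrite ?subrr ?normc0.
apply: (@one_form_unique_continuation w (g s0)) => //.
apply: (near_coord cg kappa0) => y cy /Hk[s ss sE] e ae ey.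
apply: (one_form_eq0_chart hw ae ac ey cy).
by have := Wphi s ss; rewrite /W sE coord_invK.
Qed.

End RiemannSurface.

(** * Families of curves with a compact parameter space *)

Section Families.
Variables (R : realType) (m : nat) (Z : complexManifold R m).
Variable X : complexManifold R 1.
Notation K := (Cplx R).

(** Joint continuity, with holomorphy in the curve parameter [s] and in [z] separately. *)
Definition holomorphic_family (s0 : K) (delta : R) (G : K -> Z -> X) : Prop :=
  forall s : K, normc (s - s0) < delta -> forall z : Z,
  [/\ {for (s, z), continuous (fun p : K * Z => G p.1 p.2)},
      forall c, atlas c -> cdom c (G s z) ->
        derivable (fun t : K => coord c (G t z) : K) s 1
    & forall c d, atlas c -> atlas d -> cdom c z -> cdom d (G s z) ->
        differentiable (fun v => coord d (G s (cinv c v)) : K) (cfun c z)].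

Variables (w : one_form_coef X) (s0 : K) (delta : R) (G : K -> Z -> X).
Hypotheses (hw : holomorphic_one_form w) (hG : holomorphic_family s0 delta G).
Hypothesis delta0 : 0 < delta.

Lemma family_curve_continuous (s : K) (z : Z) : normc (s - s0) < delta ->
  {for s, continuous (fun t => G t z)}.
Proof.
move=> /hG/(_ z)[Gc _ _] A /Gc [[P Q] [/= Ps Qz] PQA].
rewrite /= nbhs_simpl /=; apply: filterS Ps => t Pt.
by apply: (PQA (t, z)); split=> //; exact: nbhs_singleton.
Qed.

Lemma family_pairing_chart (s : K) (z : Z) c d : normc (s - s0) < delta ->
  atlas c -> atlas d -> cdom c (G s z) -> cdom d (G s z) ->
  pairing w c (fun t => G t z) s = pairing w d (fun t => G t z) s.
Proof.
move=> sd ac ad cg dg; apply: pairing_chart => //.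
  exact: family_curve_continuous.
by have [_ + _] := hG sd z; apply.
Qed.

(* [h] is the integral of [w] along the curve [G ^~ z] from [s0] to [s]. *)
Definition curve_integral (s : K) (z : Z) (h : K) : Prop :=
  exists (r : R) (theta : K -> K),
  [/\ normc (s - s0) < r, r <= delta, theta s0 = 0, theta s = h
    & forall t : K, normc (t - s0) < r -> forall c, atlas c -> cdom c (G t z) ->
        is_derive t 1 theta (pairing w c (fun t => G t z) t)].

(** Two primitives along the same curve differ by a function whose derivative is 0 on the segment
    from [s0] to [s]. *)
Lemma curve_integral_unique s z h h' :
  curve_integral s z h -> curve_integral s z h' -> h = h'.
Proof.
move=> [r [th [sr rd th0 <- Hth]]] [r' [th' [sr' rd' th'0 <- Hth']]].
suff : (fun t => th t - th' t) s = (fun t => th t - th' t) s0.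
  by rewrite /= th0 th'0 subrr => /eqP; rewrite subr_eq0 => /eqP.
apply: (@derive0_constant R (fun t => th t - th' t) s0 s) => t /andP[t0 t1]; set u := s0 + _.
have us : normc (u - s0) <= normc (s - s0).
  rewrite /u addrAC subrr add0r normcM normcC ger0_norm//.
  by rewrite ler_piMl// normc_ge0.
have [c ac cu] := atlas_cover (G u z).
have H := Hth u (le_lt_trans us sr) c ac cu.
have H' := Hth' u (le_lt_trans us sr') c ac cu.
by have := is_deriveB H H'; rewrite subrr.
Qed.

(** For [z] near [b] and [s] near [s0] the curves stay in a chart disc where [w] has a primitive
    [g]. The integral is the difference of [g] at the two ends, which is holomorphic in [z]. *)
Lemma curve_integral_near (b : Z) : \forall z \near b & s \near s0,
  exists eta : Z -> K, (\forall y \near z, curve_integral s y (eta y)) /\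
    forall e, atlas e -> cdom e z ->
      differentiable (fun v => eta (cinv e v)) (cfun e z).
Proof.
have s0d : normc (s0 - s0) < delta by rewrite subrr normc0.
have [c ac cb] := atlas_cover (G s0 b).
have [g [rho [rho0 Hg]]] := one_form_primitive hw ac cb.
have [Gc _ _] := hG s0d b.
have [[P Q] [/= Ps Qb] PQA] := Gc _ (nbhs_coord cb rho0).
have /nbhsC[r1 r10 Hr1] := Ps.
pose r := Num.min r1 delta; have r0 : 0 < r by rewrite lt_min r10.
have rd : r <= delta by rewrite ge_min lexx orbT.
have Hr (s : K) : normc (s - s0) < r -> P s.
  by move=> sr; apply: Hr1; apply: lt_le_trans sr _; rewrite ge_min lexx.
have GP (s : K) (y : Z) : normc (s - s0) < r -> Q y ->
    [/\ normc (s - s0) < delta, cdom c (G s y) &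
     is_derive (coord c (G s y)) 1 g (w c (G s y) 0 0)].
  move=> sr Qy; split; first exact: lt_le_trans sr rd.
    by have [] := PQA (s, y) (conj (Hr s sr) Qy).
  by have [h1 h2] := PQA (s, y) (conj (Hr s sr) Qy); exact: Hg.
exists (interior Q, [set s : K | normc (s - s0) < r]).
  split => /=; first by apply: nbhs_interior.
  by apply/nbhsC; exists r.
move=> [z s] [/= Qz sr].
pose eta (y : Z) : K := g (coord c (G s y)) - g (coord c (G s0 y)).
have s0r : normc (s0 - s0) < r by rewrite subrr normc0.
exists eta; split.
  apply: filterS Qz => y Qy.
  exists r, (fun t => g (coord c (G t y)) - g (coord c (G s0 y))).
  split=> //; first by rewrite subrr.
  move=> t tr d ad dt.
  have [td ct gd] := GP t y tr Qy.
  rewrite (@family_pairing_chart t y d c td)// /pairing.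
  have [_ /(_ c ac ct) /derivableP cd _] := hG td y.
  have H := is_deriveC_comp cd gd.
  by have := is_deriveB H (is_derive_cst (g (coord c (G s0 y))) t 1); rewrite subr0.
move=> e ae ez; have Qz1 := nbhs_singleton Qz.
have diff (t : K) : normc (t - s0) < r ->
    differentiable (fun v => g (coord c (G t (cinv e v)))) (cfun e z).
  move=> tr; have [td ct [gd _]] := GP t z tr Qz1.
  have [_ _ /(_ e c ae ac ez ct) H] := hG td z.
  apply: (derivable_differentiable_comp H).
  by rewrite cinvK.
exact: (differentiableB (diff s sr) (diff s0 s0r)).
Qed.

(* The integral of [w] along a short curve [G ^~ z] is a holomorphic function of
   [z] on the compact manifold [Z], hence constant; differentiate at [s0]. *)
Lemma pairing_family_constant (z z' : Z) c c' : compact_connected Z ->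
  atlas c -> atlas c' -> cdom c (G s0 z) -> cdom c' (G s0 z') ->
  pairing w c (fun t => G t z) s0 = pairing w c' (fun t => G t z') s0.
Proof.
move=> cZ ac ac' cz cz'.
(* Compactness of [Z] gives one neighborhood of [s0] that serves all [z]. *)
have /compact_near_coveringP cov := cZ.1.
pose P (s : K) (z : Z) := exists eta : Z -> K,
  (\forall y \near z, curve_integral s y (eta y)) /\
    forall e, atlas e -> cdom e z ->
      differentiable (fun v => eta (cinv e v)) (cfun e z).
have {}cov : \forall s \near s0, forall z, P s z.
  have := cov K (nbhs s0) P (nbhs_filter s0) (fun b _ => curve_integral_near b).
  by apply: filterS => s Hs y; exact: Hs.
have /nbhsC[r r0 Hr] := cov.
have exI (s : K) (y : Z) : normc (s - s0) < r -> exists h, curve_integral s y h.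
  by move=> /Hr/(_ y)[eta [/nbhs_singleton H _]]; exists (eta y).
have constI (s : K) (y y' : Z) h : normc (s - s0) < r ->
    curve_integral s y h -> curve_integral s y' h.
  move=> sr Hy.
  (* For fixed [s] the integrals form one function [H] on [Z]; near each point uniqueness identifies
     it with the local holomorphic [eta]. *)
  have [H HP] : {H : Z -> K & forall y, curve_integral s y (H y)}.
    by apply: (@choice Z K (curve_integral s)) => x; exact: exI.
  have Hhol : holomorphic_function H.
    move=> e ae x ex; have [eta [near_eta diff_eta]] := Hr s sr x.
    have := diff_eta e ae ex; apply: near_eq_differentiable.
    have near_v : nbhs (cfun e x) (cinv e @^-1` [set y | curve_integral s y (eta y)]).
      by apply: (cinv_continuous ex); rewrite cinvK.
    by apply: filterS near_v => v Hv; exact: curve_integral_unique Hv (HP _).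
  have := holomorphic_function_constant cZ Hhol y y'.
  by rewrite (curve_integral_unique Hy (HP y)) => ->.
have r2 : normc (s0 + (r / 2)%:C%C - s0) < r.
  by rewrite addrAC subrr add0r normcC ger0_norm; lra.
(* The primitive witnessing the integral up to [s0 + r / 2] lives on a disc of radius [r' > r / 2].
   The same function thus gives the integral for all [t] within [r / 2] of [s0], and can be
   differentiated at [s0]. *)
have thetaP (y : Z) : exists theta : K -> K,
   (forall t : K, normc (t - s0) <= r / 2 -> curve_integral t y (theta t)) /\
   forall d, atlas d -> cdom d (G s0 y) ->
     is_derive s0 1 theta (pairing w d (fun t => G t y) s0).
  have [h [r' [th [sr rd th0 _ Hth]]]] := exI _ y r2.
  have r2r' : r / 2 < r'.
    by move: sr; rewrite addrAC subrr add0r normcC ger0_norm//; lra.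
  exists th; split.
    move=> t tr; exists r', th; split=> //; exact: le_lt_trans tr r2r'.
  move=> d ad ds; apply: Hth => //; rewrite subrr normc0; lra.
have [th [thI thd]] := thetaP z; have [th' [th'I th'd]] := thetaP z'.
have th_eq : \forall t \near s0, th t = th' t.
  apply/nbhsC; exists (r / 2); first by rewrite divr_gt0.
  move=> t tr; have tr1 : normc (t - s0) < r by move: tr r0; lra.
  apply: curve_integral_unique (thI t (ltW tr)) _.
  exact: constI tr1 (th'I t (ltW tr)).
have H1 := near_eq_is_derive th_eq (thd c ac cz).
have H2 := th'd c' ac' cz'.
by rewrite -(@derive_val _ _ _ _ _ _ _ H1) (@derive_val _ _ _ _ _ _ _ H2).
Qed.

End Families.

(** * Maps of two variables *)

Section TwoVariables.
Variables (R : realType) (X : complexManifold R 1).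
Notation K := (Cplx R).

(** Pairs of charts replace product charts, so that exchanging the two variables is a mere swap of a
    pair. *)
Definition holomorphic2 m n (M : complexManifold R m) (N : complexManifold R n)
    (f : M -> N -> X) : Prop :=
  (forall x y, {for (x, y), continuous (fun p : M * N => f p.1 p.2)}) /\
  forall c d k, atlas c -> atlas d -> atlas k ->
  forall x y, cdom c x -> cdom d y -> cdom k (f x y) ->
    differentiable (fun p : 'rV[K]_m * 'rV[K]_n =>
      coord k (f (cinv c p.1) (cinv d p.2)) : K) (cfun c x, cfun d y).

Lemma differentiable_fst (U V : normedModType K) (x : U * V) :
  differentiable (fun p : U * V => p.1) x.
Proof.
have l : linear (fun p : U * V => p.1) by [].
pose h : {linear (U * V)%type -> U} :=
  HB.pack (fun p : U * V => p.1) (GRing.isLinear.Build _ _ _ _ _ l).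
apply: (@linear_differentiable _ _ _ h) => p.
exact: cvg_fst.
Qed.

Lemma differentiable_snd (U V : normedModType K) (x : U * V) :
  differentiable (fun p : U * V => p.2) x.
Proof.
have l : linear (fun p : U * V => p.2) by [].
pose h : {linear (U * V)%type -> V} :=
  HB.pack (fun p : U * V => p.2) (GRing.isLinear.Build _ _ _ _ _ l).
apply: (@linear_differentiable _ _ _ h) => p.
exact: cvg_snd.
Qed.

(** A chart of [X2] around the second component completes [k] to a product chart; the coordinate of
    the first component is then the first entry of the row. *)
Lemma holomorphic2_component m1 m2 n2 (Y1 : complexManifold R m1)
    (Y2 : complexManifold R m2) (X2 : complexManifold R n2)
    (F : prod_manifold Y1 Y2 -> prod_manifold X X2) : holomorphic F ->
  holomorphic2 (fun (y1 : Y1) (y2 : Y2) => (F (y1, y2)).1).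
Proof.
move=> [Fc Fd]; split.
  move=> x y A xA.
  have FA : nbhs (F (x, y)) [set p : X * X2 | A p.1] by apply: cvg_fst.
  have H : nbhs ((x, y) : Y1 * Y2) [set p | A (F p).1] := Fc (x, y) _ FA.
  suff : nbhs ((x, y) : Y1 * Y2) [set p | A (F (p.1, p.2)).1] by [].
  by move: H; congr nbhs; apply/funext => -[].
move=> c d k ac ad ak x y cx dy kf.
have [l al lf] := atlas_cover (F (x, y)).2.
have ecd : prod_atlas (prod_chart c d) by exists c, d.
have ekl : prod_atlas (prod_chart k l) by exists k, l.
have H := Fd (prod_chart c d) (prod_chart k l) ecd ekl (x, y) (conj cx dy) (conj kf lf).
have drow : differentiable (fun p : 'rV[K]_m1 * 'rV[K]_m2 => row_mx p.1 p.2)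
    (cfun c x, cfun d y).
  apply: differentiable_row_mx; [exact: differentiable_fst|exact: differentiable_snd].
have := differentiable_entry 0 (lshift n2 0) (differentiable_comp drow H).
rewrite (_ : (fun v => _) = (fun p : 'rV[K]_m1 * 'rV[K]_m2 =>
      coord k (F (cinv c p.1, cinv d p.2)).1 : K))//.
apply/funext => p /=.
by rewrite /prod_cfun /prod_cinv /= row_mxEl row_mxKl row_mxKr.
Qed.

Lemma holomorphic2_swap m n (M : complexManifold R m) (N : complexManifold R n)
    (f : M -> N -> X) : holomorphic2 f -> holomorphic2 (fun y x => f x y).
Proof.
move=> [fc fd]; split.
  move=> y x A /(fc x y) [[P Q] [/= Px Qy] PQ].
  exists (Q, P) => //= -[y' x'] [/= Qy' Px'].
  exact: (PQ (x', y')).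
move=> d c k ad ac ak y x dy cx kf.
have H := fd c d k ac ad ak x y cx dy kf.
have sw : differentiable (fun p : 'rV[K]_n * 'rV[K]_m => (p.2, p.1))
    (cfun d y, cfun c x).
  apply: differentiable_pair; [exact: differentiable_snd|exact: differentiable_fst].
exact: (differentiable_comp sw H).
Qed.

Section Slices.
Variables (m n : nat) (M : complexManifold R m) (N : complexManifold R n).
Variables (f : M -> N -> X).
Hypothesis hf : holomorphic2 f.

(** The complex coordinate line through [a] in the direction [e]; its values are meaningful only
    while it stays in the image of the chart. *)
Definition line (c : chart R M m) (a : M) (e : 'rV[K]_m) (s : K) : M :=
  cinv c (cfun c a + s *: e).

Lemma line0 c a e : cdom c a -> line c a e 0 = a.
Proof. by move=> ca; rewrite /line scale0r addr0 cinvK. Qed.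

Lemma chart_line c a e : cdom c a -> exists2 delta : R, 0 < delta &
  forall s : K, normc s < delta ->
    cdom c (line c a e s) /\ cfun c (line c a e s) = cfun c a + s *: e.
Proof.
move=> ca; have [rho rho0 H] := chart_ball ca.
pose E := 1 + \sum_j normc (e 0 j).
have E0 : 0 < E by rewrite ltr_pwDl// sumr_ge0// => j _; exact: normc_ge0.
exists (rho / E); first by rewrite divr_gt0.
move=> s; rewrite ltr_pdivlMr// => sE; apply: H => j.
rewrite !mxE addrAC subrr add0r normcM; apply: le_lt_trans sE.
rewrite ler_wpM2l ?normc_ge0// /E (bigD1 j)//= addrCA lerDl.
by rewrite addr_ge0// sumr_ge0// => i _; exact: normc_ge0.
Qed.

Lemma line_family c a e : atlas c -> cdom c a -> exists2 delta : R, 0 < delta &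
  (forall s : K, normc s < delta -> cdom c (line c a e s)) /\
  holomorphic_family 0 delta (fun s y => f (line c a e s) y).
Proof.
move=> ac ca; have [delta delta0 H] := chart_line e ca.
exists delta => //; split; first by move=> s /H[].
move=> s; rewrite subr0 => /H[cs fs] y.
have [fc fd] := hf.
have [d ad dy] := atlas_cover y.
split.
- move=> A /= /(fc _ y) [[P Q] [/= Ps Qy] PQ].
  have near_line : nbhs s (line c a e @^-1` P).
    have Pc : nbhs (cfun c (line c a e s)) (cinv c @^-1` P).
      by apply: (cinv_continuous cs); rewrite cinvK.
    rewrite fs in Pc.
    exact: (differentiable_continuous (differentiable_line (cfun c a) e s) Pc).
  exists (line c a e @^-1` P, Q) => //= -[t y'] [/= Pt Qy'].
  exact: (PQ (line c a e t, y')).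
- move=> k ak kf; apply/derivableC.
  have Hd := fd c d k ac ad ak _ y cs dy kf; rewrite fs in Hd.
  have dl : differentiable (fun t : K => (cfun c a + t *: e, cfun d y)) s.
    apply: differentiable_pair; first exact: differentiable_line.
    exact: differentiable_cst.
  have := differentiable_comp dl Hd.
  by rewrite /comp /= cinvK.
- move=> d' k ad' ak dy' kf.
  have Hd := fd c d' k ac ad' ak _ y cs dy' kf.
  have dl : differentiable (fun v : 'rV[K]_n => (cfun c (line c a e s), v)) (cfun d' y).
    by apply: differentiable_pair; [exact: differentiable_cst|exact: ex_diff].
  have := differentiable_comp dl Hd.
  by rewrite /comp /= cinvK.
Qed.

(** Nearby points are joined by a coordinate segment, along which the derivative of [f] vanishes;
    connectedness does the rest. *)
Lemma slice_constant y : connected [set: M] ->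
  (forall c k x e, atlas c -> atlas k -> cdom c x -> cdom k (f x y) ->
    'D_1 (fun s : K => coord k (f (line c x e s) y) : K) 0 = 0) ->
  forall x x', f x y = f x' y.
Proof.
move=> coM Hd x x'.
apply: (@connected_locally_constant M (fun z => f x y = f z y) coM _ x x' erefl).
suff loc z : \forall z' \near z, f z' y = f z y.
  by move=> z; apply: filterS (loc z) => z' ->.
have [k ak kz] := atlas_cover (f z y); have [c ac cz] := atlas_cover z.
have fcont (z0 : M) (A : set X) : nbhs (f z0 y) A -> nbhs z0 [set z' | A (f z' y)].
  move=> /(hf.1 z0 y) [[P Q] [/= Pz Qy] PQ]; apply: filterS Pz => z' Pz'.
  by apply: (PQ (z', y)); split=> //; exact: nbhs_singleton.
have near_inv : nbhs (cfun c z) (cinv c @^-1` [set z' | cdom k (f z' y)]).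
  apply: (cinv_continuous cz); rewrite cinvK//.
  by apply: fcont; exact: nbhs_cdom.
have /nbhs_rVC[r r0 Hr] := near_inv.
have [rho rho0 Hrho] := chart_ball cz.
have rr0 : 0 < Num.min r rho by rewrite lt_min r0.
apply: (@near_chart _ _ _ c z (fun z' => f z' y = f z y) _ cz rr0) => z' cz' zz'.
pose u := cfun c z' - cfun c z.
pose phi (t : K) : K := coord k (f (line c z u t) y).
have phi_d (t : R) : 0 <= t <= 1 -> is_derive ((0 + t%:C%C * (1 - 0)) : K) 1 phi 0.
  rewrite add0r subr0 mulr1 => /andP[t0 t1].
  have small j : normc ((cfun c z + t%:C%C *: u) 0 j - cfun c z 0 j) < Num.min r rho.
    rewrite !mxE addrAC subrr add0r normcM normcC ger0_norm//.
    apply: le_lt_trans (zz' j).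
    by rewrite ler_piMl// normc_ge0.
  have [|cl fl] := Hrho (cfun c z + t%:C%C *: u).
    by move=> j; have := small j; rewrite lt_min => /andP[].
  have kl : cdom k (f (line c z u t%:C%C) y).
    by apply: Hr => j; have := small j; rewrite lt_min => /andP[].
  have [delta delta0 [_ Hfam]] := line_family u ac cl.
  have s00 : normc (0 - 0 : K) < delta by rewrite subrr normc0.
  (* The hypothesis concerns parameter 0 only, so the line is restarted at its point of parameter
     [t], with the same direction. *)
  have lineE (s : K) : line c (line c z u t%:C%C) u s = line c z u (t%:C%C + s).
    by rewrite /line fl scalerDl addrA.
  have [_ /(_ k ak) + _] := Hfam 0 s00 y.
  rewrite {1}lineE addr0 => /(_ kl) /derivableP.
  rewrite (Hd c k _ u ac ak cl kl) => D0.
  pose tau (s : K) : K := - t%:C%C + 1 * s.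
  have D1 : is_derive (t%:C%C : K) 1 tau 1.
    apply/is_deriveCP => e e0; exists 1 => // h _.
    by rewrite /tau (_ : _ - 1 * h = 0) ?normc0 ?mulr_ge0 ?normc_ge0 ?ltW//; ring.
  have E0 : tau t%:C%C = 0 by rewrite /tau mul1r addrC subrr.
  move: D0; set psi := (fun s : K => _) => D0.
  have D2 : is_derive (tau t%:C%C) 1 psi 0 by rewrite E0.
  have := is_deriveC_comp D1 D2; rewrite mul0r.
  have -> // : (fun s => psi (tau s)) = phi.
  by apply/funext => s; rewrite /psi lineE /tau mul1r addrA subrr add0r.
have phi01 : phi 1 = phi 0 by exact: derive0_constant phi_d.
have l1 : line c z u 1 = z' by rewrite /line scale1r /u subrKC cinvK.
have kz' : cdom k (f (cinv c (cfun c z')) y).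
  by apply: Hr => j; have := zz' j; rewrite lt_min => /andP[].
rewrite (cinvK cz') in kz'.
apply: (cfun_inj kz' kz); rewrite -!const_mx_coord; congr const_mx.
by move: phi01; rewrite /phi l1 line0.
Qed.

End Slices.
End TwoVariables.

(** * Two independent holomorphic 1-forms *)

Section OneFormCombinations.
Variables (R : realType) (X : complexManifold R 1).
Notation K := (Cplx R).

Definition one_form_comb2 (a b : K) (w1 w2 : one_form_coef X) : one_form_coef X :=
  fun c x => a *: w1 c x + b *: w2 c x.

Lemma holomorphic_one_form_comb2 a b w1 w2 : holomorphic_one_form w1 ->
  holomorphic_one_form w2 -> holomorphic_one_form (one_form_comb2 a b w1 w2).
Proof.
move=> [t1 d1] [t2 d2]; split=> [c d ac ad x cx dx|c ac x cx].
  by rewrite /one_form_comb2 (t1 c d)// (t2 c d)// mulmxDr !scalemxAr.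
exact: (differentiableD (differentiableZ a (d1 c ac x cx))
  (differentiableZ b (d2 c ac x cx))).
Qed.

(** The default value of [genus] is 0, so a value of at least 2 comes from an actual basis. A
    relation between its first two forms is extended by zero coefficients. *)
Lemma genus_ge2 : (2 <= genus X)%N -> exists w1 w2 : one_form_coef X,
  [/\ holomorphic_one_form w1, holomorphic_one_form w2 &
    forall a b, one_form_eq (one_form_comb2 a b w1 w2) (fun _ _ => 0) ->
      a = 0 /\ b = 0].
Proof.
rewrite /genus; case: xgetP => [g _ [w [hw wfree _]]|_] //; case: g w hw wfree => [|[|g]]//.
move=> w hw wfree _; pose i0 : 'I_g.+2 := ord0; pose i1 : 'I_g.+2 := lift ord0 ord0.
exists (w i0), (w i1); split=> // a b ab.
pose A (i : 'I_g.+2) : K := if i == i0 then a else if i == i1 then b else 0.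
have A0 : one_form_eq (one_form_comb A w) (fun _ _ => 0).
  move=> c ac x cx; rewrite -(ab c ac x cx) /one_form_comb /one_form_comb2.
  rewrite !big_ord_recl big1 ?addr0; first by rewrite /A /=.
  by move=> i _; rewrite /A /= scale0r.
by split; [have := wfree A A0 i0|have := wfree A A0 i1]; rewrite /A.
Qed.

End OneFormCombinations.

(** * Dependence on a single variable *)

Section Rigidity.
Variables (R : realType) (m1 m2 : nat).
Variables (Y1 : complexManifold R m1) (Y2 : complexManifold R m2).
Variable X : complexManifold R 1.
Notation K := (Cplx R).

Lemma holomorphic_family_recenter m (Z : complexManifold R m) (G : K -> Z -> X)
    (delta : R) (s : K) : holomorphic_family 0 delta G -> normc s < delta ->
  exists2 r : R, 0 < r & holomorphic_family s r G.
Proof.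
move=> hG sd; exists (delta - normc s); first by rewrite subr_gt0.
move=> t ts; apply: hG; rewrite subr0 -(subrK s t).
by apply: le_lt_trans (le_normcD _ _) _; rewrite -ltrBrDr.
Qed.

(** Since [f] varies with its first variable, some slice has a nonzero derivative along a line by
    [slice_constant]; [pairing_neq0] then moves along the line to a parameter where [w] detects the
    velocity. *)
Lemma slice_pairing_neq0 m n (M : complexManifold R m) (N : complexManifold R n)
    (f : M -> N -> X) (w : one_form_coef X) :
  connected [set: X] -> connected [set: M] -> holomorphic2 f ->
  holomorphic_one_form w -> ~ one_form_eq w (fun _ _ => 0) ->
  ~ (forall x x' y, f x y = f x' y) ->
  exists (c : chart R M m) (a : M) (e : 'rV[K]_m) (delta : R) (s : K) (y : N),
  [/\ atlas c /\ cdom c a, forall t : K, normc t < delta -> cdom c (line c a e t),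
      holomorphic_family 0 delta (fun t z => f (line c a e t) z), normc s < delta &
      exists2 k, atlas k & cdom k (f (line c a e s) y) /\
        pairing w k (fun t => f (line c a e t) y) s != 0].
Proof.
move=> coX coM hf hw wn0 fn.
have [y [c [k [a [e [ac ak ca ka De]]]]]] : exists y c k a e,
    [/\ atlas c, atlas k, cdom c a, cdom k (f a y) &
      'D_1 (fun s : K => coord k (f (line c a e s) y) : K) 0 != 0].
  apply: contrapT => H; apply: fn => x x' y.
  apply: (slice_constant hf coM) => c k a e ac ak ca ka.
  apply/eqP; apply: contrapT => /negP D0; apply: H.
  by exists y, c, k, a, e.
have [delta delta0 [cl fam]] := line_family hf e ac ca.
have k0 : cdom k (f (line c a e 0) y) by rewrite line0.
have [|s [sd [d ad [dk dn]]]] := @pairing_neq0 R X w k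
    (fun t => f (line c a e t) y) 0 delta coX hw wn0 delta0 _ ak k0 De.
  move=> s sd; split; first exact: (family_curve_continuous fam).
  by have [_ + _] := fam s sd y.
rewrite subr0 in sd.
by exists c, a, e, delta, s, y; split=> //; exists d.
Qed.

Lemma holomorphic2_rigid (f : Y1 -> Y2 -> X) :
  compact_connected Y1 -> compact_connected Y2 -> connected [set: X] ->
  (2 <= genus X)%N -> holomorphic2 f ->
  (forall y1 y2 y2', f y1 y2 = f y1 y2') \/
  (forall y1 y1' y2, f y1 y2 = f y1' y2).
Proof.
move=> cY1 cY2 coX /genus_ge2[w1 [w2 [hw1 hw2 indep]]] hf.
apply: contrapT => /not_orP[n2 n1].
have one0 : (1 : K) <> 0 by apply/eqP; exact: oner_neq0.
have w1n0 : ~ one_form_eq w1 (fun _ _ => 0).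
  move=> w0; apply: one0; apply: (indep 1 0 _).1 => c ac x cx.
  by rewrite /one_form_comb2 scale1r scale0r addr0 w0.
have w2n0 : ~ one_form_eq w2 (fun _ _ => 0).
  move=> w0; apply: one0; apply: (indep 0 1 _).2 => c ac x cx.
  by rewrite /one_form_comb2 scale1r scale0r add0r w0.
have n2' : ~ (forall y2 y2' y1, f y1 y2 = f y1 y2').
  by move=> h; apply: n2 => y1 y2 y2'; exact: h.
have hf' := holomorphic2_swap hf.
have [c [a [e [d1 [s [y2 [[ac ca] cl fam1 sd [k1 ak1 [k1x A1]]]]]]]]] :=
  slice_pairing_neq0 coX cY1.2 hf hw1 w1n0 n1.
have [d [b [u [d2 [t [y1 [[ad db] dl fam2 td [k2 ak2 [k2x B2]]]]]]]]] :=
  slice_pairing_neq0 coX cY2.2 hf' hw2 w2n0 n2'.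
pose G1 (r : K) (z : Y2) := f (line c a e r) z.
pose G2 (r : K) (z : Y1) := f z (line d b u r).
(* The pairing with velocities along [Y1] does not depend on the point of [Y2]; [const2] is the same
   with the factors exchanged. *)
have const1 w (r : K) z z' k k' : holomorphic_one_form w -> normc r < d1 ->
    atlas k -> atlas k' -> cdom k (G1 r z) -> cdom k' (G1 r z') ->
    pairing w k (G1 ^~ z) r = pairing w k' (G1 ^~ z') r.
  move=> hw rd ak ak' kz kz'.
  have [r' r'0 fam] := holomorphic_family_recenter fam1 rd.
  exact: (pairing_family_constant hw fam r'0 cY2 ak ak' kz kz').
have const2 w (r : K) z z' k k' : holomorphic_one_form w -> normc r < d2 ->
    atlas k -> atlas k' -> cdom k (G2 r z) -> cdom k' (G2 r z') ->
    pairing w k (G2 ^~ z) r = pairing w k' (G2 ^~ z') r.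
  move=> hw rd ak ak' kz kz'.
  have [r' r'0 fam] := holomorphic_family_recenter fam2 rd.
  exact: (pairing_family_constant hw fam r'0 cY1 ak ak' kz kz').
(* The two nonzero pairings were found on different slices; constancy brings both to the common
   point [(a0, b0)]. *)
pose a0 := line c a e s; pose b0 := line d b u t.
have [k ak kx] := atlas_cover (f a0 b0).
have A1k : pairing w1 k (G1 ^~ b0) s != 0.
  by rewrite (const1 w1 s b0 y2 k k1 hw1 sd ak ak1 kx k1x); exact: A1.
have B2k : pairing w2 k (G2 ^~ a0) t != 0.
  by rewrite (const2 w2 t a0 y1 k k2 hw2 td ak ak2 kx k2x); exact: B2.
have [w2k P2] : w2 k (f a0 b0) 0 0 != 0 /\
    'D_1 (fun r : K => coord k (G2 r a0) : K) t != 0.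
  by move: B2k; rewrite /pairing mulf_eq0 negb_or => /andP[].
have [w1k P1] : w1 k (f a0 b0) 0 0 != 0 /\
    'D_1 (fun r : K => coord k (G1 r b0) : K) s != 0.
  by move: A1k; rewrite /pairing mulf_eq0 negb_or => /andP[].
(* This ratio makes [w] vanish at [f a0 b0], while [w] is not the zero form, its coefficient on [w1]
   being 1. *)
pose q := w1 k (f a0 b0) 0 0 / w2 k (f a0 b0) 0 0.
pose w := one_form_comb2 1 (- q) w1 w2.
have hw : holomorphic_one_form w by exact: holomorphic_one_form_comb2.
have wn0 : ~ one_form_eq w (fun _ _ => 0) by move=> /indep[].
have wk : w k (f a0 b0) 0 0 = 0.
  by rewrite /w /one_form_comb2 !mxE /q; field.
have [r r0 fam] := holomorphic_family_recenter fam1 sd.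
pose rho := Num.min r (d1 - normc s).
have rho0 : 0 < rho by rewrite lt_min r0 subr_gt0.
have [|s' [s's [l al [lx wl]]]] := @pairing_neq0 R X w k (G1 ^~ b0) s rho coX hw
    wn0 rho0 _ ak kx P1.
  move=> z; rewrite lt_min => /andP[zr _]; split.
    exact: (family_curve_continuous fam).
  by have [_ + _] := fam z zr b0.
pose a1 := line c a e s'.
have wlx : w l (f a1 b0) 0 0 != 0.
  by move: wl; rewrite /pairing mulf_eq0 negb_or => /andP[].
(* Constancy along [Y1] carries the zero of the pairing from [a0] to [a1]. There [w] itself is
   nonzero, so the velocity along [Y2] must vanish, whereas its pairing with [w2] is nonzero by the
   same constancy. *)
have : pairing w l (G2 ^~ a1) t = 0.
  by rewrite (const2 w t a1 a0 l k hw td al ak lx kx) /pairing wk mul0r.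
move=> /eqP; rewrite /pairing mulf_eq0 (negPf wlx) /= => /eqP Dl.
move: B2k; rewrite (const2 w2 t a0 a1 k l hw2 td ak al kx lx) /pairing.
by rewrite Dl mulr0 eqxx.
Qed.

End Rigidity.

Theorem corollary1p5 (R : realType) (m1 m2 n2 : nat)
  (Y1 : complexManifold R m1) (Y2 : complexManifold R m2)
  (X1 : complexManifold R 1) (X2 : complexManifold R n2)
  (hY1 : compact_connected Y1) (hY2 : compact_connected Y2)
  (hX1 : compact_connected X1) (hX2 : compact_connected X2)
  (hgenus : (2 <= genus X1)%N)
  (F : prod_manifold Y1 Y2 -> prod_manifold X1 X2)
  (hF : holomorphic F) :
  (exists f1 : Y1 -> X1, forall y1 y2,
     F (y1, y2) = (f1 y1, (F (y1, y2)).2)) \/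
  (exists f1 : Y2 -> X1, forall y1 y2,
     F (y1, y2) = (f1 y2, (F (y1, y2)).2)).
Proof.
(* On an empty surface every form would equal 0, contradicting the independence of two forms. *)
have [x0] : exists x : X1, True.
  apply: contrapT => noX; have [w1 [w2 [_ _ indep]]] := genus_ge2 hgenus.
  have [|/eqP] := indep 1 1; last by rewrite oner_eq0.
  by move=> c ac x cx; exfalso; apply: noX; exists x.
move=> _; have hf := holomorphic2_component hF.
have [H|H] := holomorphic2_rigid hY1 hY2 hX1.2 hgenus hf; [left|right].
(* The hypotheses allow [Y2] to be empty, so no base point is fixed in it: the value is picked among
   those taken on the slice, with default [x0]. *)
- exists (fun y1 => xget x0 [set x | exists y2, x = (F (y1, y2)).1]) => y1 y2.
  case: xgetP => [x _ [y2' ->]|]; last by move=> /(_ (F (y1, y2)).1) [] ; exists y2.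
  by rewrite (H y1 y2' y2) -surjective_pairing.
- exists (fun y2 => xget x0 [set x | exists y1, x = (F (y1, y2)).1]) => y1 y2.
  case: xgetP => [x _ [y1' ->]|]; last by move=> /(_ (F (y1, y2)).1) []; exists y1.
  by rewrite (H y1' y1 y2) -surjective_pairing.
Qed.
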